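(* Let $K\ge 1$, $K'\ge 0$, and let $f=h+\overline{g}$ be a $(K,K')$-elliptic harmonic mapping in $\mathbb{D}$ with $f(0)=0$ and $\lambda_f(0)=1$, where $h,g$ are analytic in $\mathbb{D}$ with Taylor expansions $$h(z)=\sum_{n=0}^\infty a_n z^n,\qquad g(z)=\sum_{n=1}^\infty b_n z^n,\qquad z\in\mathbb{D}.$$ If $\lambda_f(z)\le \lambda$ for all $z\in\mathbb{D}$, then $$|a_n|+|b_n|\le \frac1n\left(K\lambda+\frac{2(K'-1)}{K\lambda+\sqrt{K^2\lambda^2+4K'}}\right),\qquad n=2,3,\dots.$$ Moreover, for $K=1$, $K'=0$ and each $n=2,3,\dots$, equality holds in the inequality $$|a_n|+|b_n|\le \frac1n\left(K\lambda+\frac{2(K'-1)}{K\lambda+\sqrt{K^2\lambda^2+4K'}}\right)$$ (for that index $n$) for the function $$F_n(z)=\lambda^2 z-\int_0^z\frac{\lambda^3-\lambda}{\lambda+\zeta^{n-1}}\,d\zeta,\qquad z\in\mathbb{D}.$$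
   Context: $\mathbb{D}$ is the open unit disk in $\mathbb{C}$. For a continuously differentiable $f=u+iv$ with $z=x+iy$: $f_z=\frac12(f_x-if_y)$, $f_{\bar z}=\frac12(f_x+if_y)$, $J_f=|f_z|^2-|f_{\bar z}|^2$, $\Lambda_f(z)=|f_z(z)|+|f_{\bar z}(z)|$, and $\lambda_f(z)=\bigl||f_z(z)|-|f_{\bar z}(z)|\bigr|$. $D_f=\begin{pmatrix}u_x&u_y\\ v_x&v_y\end{pmatrix}$, and for a real $2\times2$ matrix $A$, $\|A\|=\sup\{|Az|:|z|=1\}$. A sense-preserving continuous mapping $f$ from $\mathbb{D}$ into $\mathbb{C}$ is $(K,K')$-elliptic (with $K\ge1$, $K'\ge0$) if: (i) $f$ is absolutely continuous on lines in $\mathbb{D}$, i.e., for every closed rectangle $R\subset\mathbb{D}$, $f$ is absolutely continuous on almost every line segment in $R$ parallel to the coordinate axes; (ii) $f_z,f_{\bar z}\in L^2(\mathbb{D})$ and $J_f\ne0$ a.e. in $\mathbb{D}$; (iii) $\|D_f\|^2\le KJ_f+K'$ a.e. in $\mathbb{D}$. A mapping $f$ is harmonic on $\mathbb{D}$ if it is twice continuously differentiable and $4f_{z\bar z}=0$ there. A $(K,K')$-elliptic harmonic mapping is a harmonic mapping that is $(K,K')$-elliptic. *)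

(* Defs.v *)
(* MathComp-Analysis: R is any realType and the complex numbers are R[i].
   Functions on the unit disk are total functions R[i] -> R[i] of which only
   the values on the disk are ever constrained. *)
From HB Require Import structures.
From mathcomp Require Import all_boot all_order all_algebra.
From mathcomp Require Import all_classical all_reals all_analysis.
From mathcomp Require Export complex.

Set Implicit Arguments.
Unset Strict Implicit.
Unset Printing Implicit Defensive.

Import Order.TTheory GRing.Theory Num.Theory.
Import numFieldNormedType.Exports.
Export Normc.

Local Open Scope classical_set_scope.
Local Open Scope ring_scope.
Local Open Scope complex_scope.

Definition unit_disk (R : realType) : set R[i] := [set z | normc z < 1].

(* Partial derivatives f_x = u_x + i v_x and f_y = u_y + i v_y of f = u + i v.
   [derive1] is total, with an unspecified value where the derivative does not
   exist. *)
Definition dx (R : realType) (f : R[i] -> R[i]) (z : R[i]) : R[i] :=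
  derive1 (fun x : R => complex.Re (f (x +i* complex.Im z))) (complex.Re z)
  +i* derive1 (fun x : R => complex.Im (f (x +i* complex.Im z))) (complex.Re z).

Definition dy (R : realType) (f : R[i] -> R[i]) (z : R[i]) : R[i] :=
  derive1 (fun y : R => complex.Re (f (complex.Re z +i* y))) (complex.Im z)
  +i* derive1 (fun y : R => complex.Im (f (complex.Re z +i* y))) (complex.Im z).

Definition dz (R : realType) (f : R[i] -> R[i]) (z : R[i]) : R[i] :=
  2^-1 * (dx f z - 'i * dy f z).

Definition dzbar (R : realType) (f : R[i] -> R[i]) (z : R[i]) : R[i] :=
  2^-1 * (dx f z + 'i * dy f z).

Definition jac (R : realType) (f : R[i] -> R[i]) (z : R[i]) : R :=
  normc (dz f z) ^+ 2 - normc (dzbar f z) ^+ 2.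

Definition min_dilation (R : realType) (f : R[i] -> R[i]) (z : R[i]) : R :=
  `| normc (dz f z) - normc (dzbar f z) |.

Definition formal_differential (R : realType) (f : R[i] -> R[i]) (z : R[i]) :
    'M[R]_2 :=
  \matrix_(i < 2, j < 2)
    let w := if j == 0 then dx f z else dy f z in
    if i == 0 then complex.Re w else complex.Im w.

(* A acting on the plane, (x, y) being identified with x + i y *)
Definition mx_act (R : realType) (A : 'M[R]_2) (z : R[i]) : R[i] :=
  (A 0 0 * complex.Re z + A 0 1 * complex.Im z)
  +i* (A 1 0 * complex.Re z + A 1 1 * complex.Im z).

Definition op_norm (R : realType) (A : 'M[R]_2) : R :=
  sup [set normc (mx_act A z) | z in [set z | normc z = 1]].

Definition abs_continuous (R : realType) (a b : R) (phi : R -> R[i]) : Prop :=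
  forall e : R, 0 < e -> exists2 d : R, 0 < d &
    forall s : seq (R * R),
      all (fun I => [&& a <= I.1, I.1 <= I.2 & I.2 <= b]) s ->
      pairwise (fun I J => (I.2 <= J.1) || (J.2 <= I.1)) s ->
      \sum_(I <- s) (I.2 - I.1) < d ->
      \sum_(I <- s) normc (phi I.2 - phi I.1) < e.

Definition ACL (R : realType) (f : R[i] -> R[i]) : Prop :=
  forall a b c d : R, a < b -> c < d ->
    (forall x y : R, a <= x <= b -> c <= y <= d -> unit_disk (x +i* y)) ->
    {ae (@lebesgue_measure R), forall y : R, c <= y <= d ->
       abs_continuous a b (fun x => f (x +i* y))} /\
    {ae (@lebesgue_measure R), forall x : R, a <= x <= b ->
       abs_continuous c d (fun y => f (x +i* y))}.

Definition cplx (R : realType) (p : R * R) : R[i] := p.1 +i* p.2.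

Notation area R := ((@lebesgue_measure R) \x (@lebesgue_measure R))%E
  (only parsing).

Definition ae_disk (R : realType) (P : R[i] -> Prop) : Prop :=
  {ae area R, forall p : R * R, unit_disk (cplx p) -> P (cplx p)}.

Definition L2_disk (R : realType) (phi : R[i] -> R[i]) : Prop :=
  let D : set (measurableTypeR R * measurableTypeR R) :=
    [set p | unit_disk (cplx p)] in
  [/\ measurable_fun D
        (fun p : measurableTypeR R * measurableTypeR R =>
           complex.Re (phi (cplx p)) : measurableTypeR R),
      measurable_fun D
        (fun p : measurableTypeR R * measurableTypeR R =>
           complex.Im (phi (cplx p)) : measurableTypeR R) &
      (\int[area R]_(p in D) (normc (phi (cplx p)) ^+ 2)%:E < +oo)%E].

Definition cis (R : realType) (t : R) : R[i] := cos t +i* sin t.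

(* The closed curve gamma on [0, 2 pi] avoids 0 and winds k times around it:
   theta is a continuous branch of the argument of gamma. *)
Definition winds (R : realType) (gamma : R -> R[i]) (k : int) : Prop :=
  exists theta : R -> R,
    [/\ {within `[0, 2 * pi], continuous theta},
        forall t : R, 0 <= t <= 2 * pi ->
          normc (gamma t) != 0 /\
          gamma t = (normc (gamma t))%:C * cis (theta t) &
        theta (2 * pi) - theta 0 = 2 * pi * k%:~R].

(* Sense-preserving for a map that is only continuous: the topological degree
   of f is positive, i.e. on every disk B with closure in the unit disk, f has
   positive degree (= winding number of f along the boundary of B) at every
   point w of f(B) \ f(bd B). *)
Definition sense_preserving (R : realType) (f : R[i] -> R[i]) : Prop :=
  forall (c : R[i]) (r : R), 0 < r ->
    (forall z, normc (z - c) <= r -> unit_disk z) ->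
    forall z1, normc (z1 - c) < r ->
      (forall z, normc (z - c) = r -> f z != f z1) ->
      exists2 k : int, 0 < k &
        winds (fun t => f (c + r%:C * cis t) - f z1) k.

Definition continuous_on_disk (R : realType) (f : R[i] -> R[i]) : Prop :=
  forall z : R[i], unit_disk z ->
    {for z, continuous (f : R[i]^o -> R[i]^o)}.

Definition elliptic (R : realType) (K K' : R) (f : R[i] -> R[i]) : Prop :=
  [/\ continuous_on_disk f,
      sense_preserving f,
      ACL f,
      [/\ L2_disk (dz f), L2_disk (dzbar f) &
          ae_disk (fun z => jac f z != 0)] &
      ae_disk (fun z =>
        op_norm (formal_differential f z) ^+ 2 <= K * jac f z + K')].

Definition C1_on_disk (R : realType) (f : R[i] -> R[i]) : Prop :=
  (forall z : R[i], unit_disk z ->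
    [/\ derivable (fun x : R => complex.Re (f (x +i* complex.Im z)))
          (complex.Re z) 1,
        derivable (fun x : R => complex.Im (f (x +i* complex.Im z)))
          (complex.Re z) 1,
        derivable (fun y : R => complex.Re (f (complex.Re z +i* y)))
          (complex.Im z) 1 &
        derivable (fun y : R => complex.Im (f (complex.Re z +i* y)))
          (complex.Im z) 1]) /\
  continuous_on_disk (dx f) /\ continuous_on_disk (dy f).

Definition harmonic_map (R : realType) (f : R[i] -> R[i]) : Prop :=
  [/\ C1_on_disk f, C1_on_disk (dx f), C1_on_disk (dy f) &
      forall z, unit_disk z -> 4 * dzbar (dz f) z = 0].

(* h is analytic in the unit disk with Taylor coefficients a *)
Definition taylor_on_disk (R : realType) (h : R[i] -> R[i]) (a : nat -> R[i])
    : Prop :=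
  forall z : R[i], unit_disk z ->
    series (fun n => a n * z ^+ n : R[i]^o) @ \oo --> (h z : R[i]^o).

Definition coef_bound (R : realType) (K K' lambda : R) (n : nat) : R :=
  n%:R^-1 * (K * lambda + 2 * (K' - 1) /
    (K * lambda + Num.sqrt (K ^+ 2 * lambda ^+ 2 + 4 * K'))).

(* int_0^z phi(zeta) dzeta along the segment zeta = t z, 0 <= t <= 1 *)
Definition segment_integral (R : realType) (phi : R[i] -> R[i]) (z : R[i])
    : R[i] :=
  z * (Rintegral (@lebesgue_measure R) `[0, 1]
         (fun t : R => complex.Re (phi (t%:C * z)))
       +i* Rintegral (@lebesgue_measure R) `[0, 1]
         (fun t : R => complex.Im (phi (t%:C * z)))).

Definition extremal (R : realType) (lambda : R) (n : nat) (z : R[i]) : R[i] :=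
  (lambda ^+ 2)%:C * z -
  segment_integral
    (fun zeta => (lambda ^+ 3 - lambda)%:C / (lambda%:C + zeta ^+ n.-1)) z.

(* Main.v *)
(* Let M = (K lambda + sqrt (K^2 lambda^2 + 4 K')) / 2, the positive root of
   M^2 = K lambda M + K'. Quasiconformality gives |h'| + |g'| <= M almost
   everywhere, hence everywhere by continuity, and the claimed bound is
   (M - 1/M) / n. For each unimodular d the analytic function F = h' + d g' is
   bounded by M, so its coefficients satisfy |c_k| <= M - |c_0|^2 / M. Choose d
   so that n a_n and d n b_n add up without cancellation, and note that
   |c_0| >= ||a_1| - |b_1|| = 1.
   The extremal map has derivative lambda (1 + lambda z^(n-1)) / (lambda + z^(n-1)),
   lambda times a Blaschke-type quotient. It is sense-preserving because,
   as for any analytic map, it winds around an attained value like one of its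
   Taylor polynomials (Rouche), and there the winding number counts roots. *)
Require Import Defs.
From mathcomp Require Import all_boot all_order all_algebra.
From mathcomp Require Import all_classical all_reals all_analysis.
From mathcomp Require Import complex.
From mathcomp Require Import measurable_realfun ring lra.

Set Implicit Arguments.
Unset Strict Implicit.
Unset Printing Implicit Defensive.

Import Order.TTheory GRing.Theory Num.Theory.
Import numFieldNormedType.Exports.

Local Open Scope classical_set_scope.
Local Open Scope ring_scope.
Local Open Scope complex_scope.
Local Open Scope ring_scope.

Local Arguments normc : simpl never.

(** * Complex moduli and limits *)

(** Analytic functions enter only through their power series, and no contour integral is taken.
    Estimates on closed disks of radius r < 1 come from geometric domination of the coefficients.
    Cauchy averages become sums over roots of unity, which are exact on Taylor polynomials once
    there are enough roots. In the coefficient bound the test function has a free parameter al: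
    averaging gives |c_k + 2 al c_0| <= M (1 + |al|^2), and |al| = |c_0| / M with a suitable
    argument turns this into |c_k| + 2 |c_0|^2 / M <= M + |c_0|^2 / M. Partial derivatives are total
    functions, unspecified where no derivative exists. [rdiff] therefore records a first-order
    expansion in w - z and its conjugate, from which every partial is read off; for f = h + conj g
    it yields f_z = h' and f_zbar = conj g'. In the extremal clause, [1 <= lambda] is what the
    normalization lambda_f(0) = 1 forces anyway. *)

Section ComplexNorm.
Variable R : realType.
Implicit Types (x y r : R) (z w : R[i]).

Lemma normr_normc z : `|z| = (normc z)%:C.
Proof. by case: z => a b; rewrite normc_def. Qed.

Lemma normc_ge0 z : 0 <= normc z.
Proof. by case: z => a b; exact: sqrtr_ge0. Qed.

Lemma normcB z w : normc (z - w) = normc (w - z).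
Proof. by rewrite -normcN opprB. Qed.

Lemma normcR x : normc x%:C = `|x|.
Proof. by rewrite /normc /= expr0n addr0 sqrtr_sqr. Qed.

Lemma normcX z n : normc (z ^+ n) = normc z ^+ n.
Proof. by elim: n => [|n IH]; rewrite ?expr0 ?normc1 // !exprS normcM IH. Qed.

Lemma normc_conj z : normc z^* = normc z.
Proof. by case: z => a b; rewrite /normc /= sqrrN. Qed.

Lemma conjB z w : (z - w)^* = z^* - w^*.
Proof. exact: rmorphB. Qed.

Lemma conjM z w : (z * w)^* = z^* * w^*.
Proof. exact: rmorphM. Qed.

Lemma conjK z : z^*^* = z.
Proof. exact: conjCK. Qed.

Lemma conjR x : (x%:C)^* = x%:C.
Proof. exact: conjc_real. Qed.

Lemma normc_eq0 z : (normc z == 0) = (z == 0).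
Proof.
by apply/eqP/eqP => [/eq0_normc//|->]; exact: normc0.
Qed.

Lemma normc_gt0 z : (0 < normc z) = (z != 0).
Proof. by rewrite lt_def normc_ge0 andbT normc_eq0. Qed.

Lemma normc_div z w : normc (z / w) = normc z / normc w.
Proof. by rewrite normcM normcV. Qed.

Lemma normc_nat n : normc (n%:R : R[i]) = n%:R.
Proof. by rewrite -(rmorph_nat (real_complex R)) normcR ger0_norm. Qed.

Lemma sqr_normcE z : normc z ^+ 2 = complex.Re z ^+ 2 + complex.Im z ^+ 2.
Proof. by case: z => a b; rewrite /normc /= sqr_sqrtr// addr_ge0// sqr_ge0. Qed.

Lemma mulcJ z : z * z^* = (normc z ^+ 2)%:C.
Proof.
rewrite sqr_normcE; case: z => a b; apply/eqP; rewrite eq_complex/=.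
by apply/andP; split; apply/eqP; ring.
Qed.

Lemma le_normcB z w : normc (z - w) <= normc z + normc w.
Proof. by rewrite -(normcN w) le_normcD. Qed.

Lemma normc_triB z w u : normc (z - u) <= normc (z - w) + normc (w - u).
Proof. by rewrite (_ : z - u = (z - w) + (w - u)) ?le_normcD//; ring. Qed.

Lemma ler_normc_sub z w : normc z - normc w <= normc (z - w).
Proof. by rewrite lerBlDr -{1}(subrK w z) le_normcD. Qed.

Lemma ler_dist_normc z w : `|normc z - normc w| <= normc (z - w).
Proof.
by rewrite ler_norml lerNl opprB {1}normcB !ler_normc_sub.
Qed.

Lemma normc_sum (I : Type) (s : seq I) (P : pred I) (F : I -> R[i]) :
  normc (\sum_(i <- s | P i) F i) <= \sum_(i <- s | P i) normc (F i).
Proof.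
elim/big_ind2 : _ => //; first by rewrite normc0.
by move=> u1 v1 u2 v2 h1 h2; apply: le_trans (le_normcD _ _) (lerD h1 h2).
Qed.

Lemma ReB z w : complex.Re (z - w) = complex.Re z - complex.Re w.
Proof. by case: z w => [a b] [c d]. Qed.

Lemma ImB z w : complex.Im (z - w) = complex.Im z - complex.Im w.
Proof. by case: z w => [a b] [c d]. Qed.

Lemma Re_le_normc z : `|complex.Re z| <= normc z.
Proof. by rewrite -lecR -normr_normc normc_ge_Re. Qed.

Lemma Im_le_normc z : `|complex.Im z| <= normc z.
Proof.
rewrite -(@ler_pXn2r _ 2)// ?nnegrE ?normc_ge0//.
by rewrite sqr_normcE real_normK ?num_real// lerDr sqr_ge0.
Qed.

Lemma normc_le_ReIm z : normc z <= `|complex.Re z| + `|complex.Im z|.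
Proof.
rewrite -(@ler_pXn2r _ 2)// ?nnegrE ?normc_ge0 ?addr_ge0//.
rewrite sqr_normcE sqrrD !real_normK ?num_real//.
by rewrite lerD2r lerDl mulrn_wge0// mulr_ge0.
Qed.

Lemma Re0_disk r : `|r| < 1 -> unit_disk r%:C.
Proof. by rewrite /unit_disk/= -(normcR r). Qed.

Lemma unit_disk0 : unit_disk (0 : R[i]).
Proof. by rewrite /unit_disk/= normc0. Qed.

(** The quotient of the directions of z and w rotates w onto the ray of z. This serves whenever a
    triangle inequality has to be attained: for operator norms, for adding coefficients, and for the
    farthest point of a disk. *)
Lemma align z w : exists2 d : R[i], normc d = 1 &
  normc (z + d * w) = normc z + normc w.
Proof.
have [->|z0] := eqVneq z 0; first by exists 1; rewrite ?normc1// mul1r normc0 !add0r.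
have [->|w0] := eqVneq w 0; first by exists 1; rewrite ?normc1// mulr0 normc0 !addr0.
have nz : normc z != 0 by rewrite normc_eq0.
have nw : normc w != 0 by rewrite normc_eq0.
exists (z / (normc z)%:C / (w / (normc w)%:C)).
  by rewrite !normc_div !normcR !ger0_norm ?normc_ge0// !divff// divr1.
have -> : z + z / (normc z)%:C / (w / (normc w)%:C) * w =
  z / (normc z)%:C * (normc z + normc w)%:C.
  rewrite rmorphD /=; field; rewrite w0 /= -!(rmorph0 (real_complex R)).
  by rewrite !(inj_eq (@complexI R)) nz nw.
rewrite normcM normc_div !normcR !ger0_norm ?addr_ge0 ?normc_ge0//.
by rewrite divff// mul1r.
Qed.

End ComplexNorm.

Section ComplexLimits.
Variable R : realType.
Implicit Types (u v : nat -> R[i]) (l m : R[i]).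

(** The topology of [R[i]^o] uses radii in the partially ordered field [R[i]]; here the radius is a
    real number, so that [lra] and [nra] apply. *)
Definition climit u l := forall e : R, 0 < e ->
  exists N, forall n, (N <= n)%N -> normc (u n - l) < e.

Lemma cvg_climit u l : (u : nat -> R[i]^o) @ \oo --> (l : R[i]^o) <-> climit u l.
Proof.
split=> [/cvgrPdist_lt ul e e0|ul].
  have e0' : 0 < e%:C by rewrite -(rmorph0 (real_complex R)) ltcR.
  have [N _ HN] := ul _ e0'; exists N => n Nn.
  have := HN n Nn; rewrite /= normcB -ltcR -normr_normc; exact.
apply/cvgrPdist_lt => e e0.
have [e1 e1E] : exists e1 : R, e = e1%:C.
  by apply/complex_realP; rewrite realE ltW.
have [|N HN] := ul e1.
  by move: e0; rewrite e1E -(rmorph0 (real_complex R)) ltcR.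
by exists N => // n /= Nn; rewrite e1E normr_normc ltcR normcB HN.
Qed.

Lemma climit_eq u v l : u =1 v -> climit u l -> climit v l.
Proof. by move=> /funext ->. Qed.

Lemma climit_cst l : climit (fun=> l) l.
Proof. by move=> e e0; exists 0%N => n _; rewrite subrr normc0. Qed.

Lemma climitD u v l m : climit u l -> climit v m ->
  climit (fun n => u n + v n) (l + m).
Proof.
move=> ul vm e e0; have e2 : 0 < e / 2 by rewrite divr_gt0.
have [N HN] := ul _ e2; have [M HM] := vm _ e2.
exists (maxn N M) => n; rewrite geq_max => /andP[/HN h1 /HM h2].
rewrite opprD addrACA; apply: le_lt_trans (le_normcD _ _) _.
by rewrite (splitr e) ltrD.
Qed.

Lemma climitZ u l c : climit u l -> climit (fun n => c * u n) (c * l).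
Proof.
move=> ul e e0; have c0 : 0 < normc c + 1 by rewrite ltr_wpDl ?normc_ge0.
have [|N HN] := ul (e / (normc c + 1)); first by rewrite divr_gt0.
exists N => n /HN; rewrite ltr_pdivlMr// => h.
rewrite -mulrBr normcM; apply: le_lt_trans h.
by rewrite mulrC ler_wpM2l ?normc_ge0// lerDl.
Qed.

Lemma climitN u l : climit u l -> climit (fun n => - u n) (- l).
Proof.
move=> /(climitZ (-1)); rewrite mulN1r; apply: climit_eq => n.
by rewrite mulN1r.
Qed.

Lemma climitB u v l m : climit u l -> climit v m ->
  climit (fun n => u n - v n) (l - m).
Proof. by move=> ul /climitN; exact: climitD. Qed.

Lemma climit_shift u l k : climit u l -> climit (fun n => u (n + k)%N) l.
Proof.
move=> ul e /ul[N HN]; exists N => n Nn; apply: HN.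
by rewrite (leq_trans Nn)// leq_addr.
Qed.

Lemma climit_le u l (B : R) : climit u l ->
  (exists N, forall n, (N <= n)%N -> normc (u n) <= B) -> normc l <= B.
Proof.
move=> ul [M HM]; apply/ler_addgt0Pr => e e0.
have [N HN] := ul _ e0.
have := HN _ (leq_maxl N M); have := HM _ (leq_maxr N M).
have := le_normcB (u (maxn N M)) (u (maxn N M) - l).
rewrite opprB addrCA subrr addr0 => h1 h2 h3.
by rewrite (le_trans h1)// lerD// ltW.
Qed.

Lemma climit_uniq u l m : climit u l -> climit u m -> l = m.
Proof.
move=> ul um; apply/eqP; rewrite -subr_eq0 -normc_eq0 eq_le normc_ge0 andbT.
have := climitB ul um => /climit_le; apply; exists 0%N => n _.
by rewrite subrr normc0.
Qed.

Lemma climit_ReIm u l :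
  (fun n => complex.Re (u n)) @ \oo --> complex.Re l ->
  (fun n => complex.Im (u n)) @ \oo --> complex.Im l -> climit u l.
Proof.
move=> /cvgrPdist_lt ul /cvgrPdist_lt um e e0.
have e2 : 0 < e / 2 by rewrite divr_gt0.
have [N _ HN] := ul _ e2; have [M _ HM] := um _ e2.
exists (maxn N M) => n; rewrite geq_max => /andP[/HN h1 /HM h2].
apply: le_lt_trans (normc_le_ReIm _) _.
rewrite (splitr e) ReB ImB distrC [X in _ + X]distrC.
by rewrite ltrD.
Qed.

Lemma climit_Re u l : climit u l -> (fun n => complex.Re (u n)) @ \oo --> complex.Re l.
Proof.
move=> ul; apply/cvgrPdist_lt => e /ul[N HN]; exists N => // n /= /HN.
rewrite distrC; apply: le_lt_trans.
by rewrite -ReB Re_le_normc.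
Qed.

Lemma climit_Im u l : climit u l -> (fun n => complex.Im (u n)) @ \oo --> complex.Im l.
Proof.
move=> ul; apply/cvgrPdist_lt => e /ul[N HN]; exists N => // n /= /HN.
rewrite distrC; apply: le_lt_trans.
by rewrite -ImB Im_le_normc.
Qed.

Lemma geo_sum_le (q : R) n : 0 <= q < 1 -> \sum_(i < n) q ^+ i <= (1 - q)^-1.
Proof.
move=> /andP[q0 q1]; have q1' : 0 < 1 - q by rewrite subr_gt0.
rewrite -(ler_pM2l q1') divff ?gt_eqF// -[X in X <= _]opprK -mulNr opprB.
by rewrite -subrX1 opprB lerBlDr lerDl exprn_ge0.
Qed.

(** Completeness is used in the reals only: both component series are dominated by the same
    geometric series. *)
Lemma climit_geo u (B q : R) : 0 <= q < 1 ->
  (forall n, normc (u n) <= B * q ^+ n) ->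
  exists l, climit (fun n => \sum_(i < n) u i) l.
Proof.
move=> /andP[q0 q1] uB.
have key (p : R[i] -> R) : (forall z, `|p z| <= normc z) ->
    cvgn (series (fun n => p (u n))).
  move=> pn; apply: normed_cvg; apply: (@series_le_cvg _ _ (fun n => B * q ^+ n)).
  - by move=> n; exact: normr_ge0.
  - by move=> n; rewrite (le_trans (normc_ge0 (u n))).
  - by move=> n; rewrite (le_trans (pn _)).
  - apply: (@is_cvg_geometric_series R B q); by rewrite ger0_norm.
have cR := key _ (@Re_le_normc R); have cI := key _ (@Im_le_normc R).
have sE (p : R[i] -> R) n : p 0 = 0 -> (forall x y, p (x + y) = p x + p y) ->
    p (\sum_(i < n) u i) = series (fun n => p (u n)) n.
  move=> p0 pD; rewrite /series /= big_mkord.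
  by elim: n => [|n IH]; rewrite ?big_ord0// !big_ord_recr/= pD IH.
exists ((limn (series (fun n => complex.Re (u n)))) +i*
        (limn (series (fun n => complex.Im (u n))))).
apply: climit_ReIm => /=.
- rewrite (_ : (fun n => _) = series (fun n => complex.Re (u n)))//.
  by apply/funext => n; rewrite sE// => -[? ?] [? ?].
- rewrite (_ : (fun n => _) = series (fun n => complex.Im (u n)))//.
  by apply/funext => n; rewrite sE// => -[? ?] [? ?].
Qed.

End ComplexLimits.

(** * Power series on the unit disk *)

Section PowerSeries.
Variable R : realType.
Implicit Types (a b : nat -> R[i]) (h k : R[i] -> R[i]) (r q B : R) (z w : R[i]).

Definition psum a z n := \sum_(i < n) a i * z ^+ i.

(** Abel's form of having radius of convergence at least 1. It involves moduli of coefficients only,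
    which makes it easy to carry over to the differentiated series. *)
Definition radius_ge1 a := forall r, 0 < r < 1 ->
  exists B, forall n, normc (a n) * r ^+ n <= B.

Definition diff_coef a n := n.+1%:R * a n.+1.

Lemma taylorP h a : taylor_on_disk h a <->
  forall z, unit_disk z -> climit (psum a z) (h z).
Proof.
have E z : series (fun n => a n * z ^+ n : R[i]^o) = psum a z.
  by apply/funext => n; rewrite /series/= big_mkord.
by split=> H z /H; rewrite E => /cvg_climit.
Qed.

(** From some index on, consecutive partial sums at r are within 1 of the limit, so a term has
    modulus at most 2; the finitely many earlier terms are added to the bound. *)
Lemma taylor_radius h a : taylor_on_disk h a -> radius_ge1 a.
Proof.
move=> /taylorP ha r /andP[r0 r1].
have rd : unit_disk (r%:C : R[i]) by apply: Re0_disk; rewrite gtr0_norm.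
have [N HN] := ha _ rd _ ltr01.
exists (2 + \sum_(i < N) normc (a i) * r ^+ i) => n.
have [nN|Nn] := ltnP n N.
  rewrite (bigD1 (Ordinal nN))//= addrCA lerDl addr_ge0//.
  by apply: sumr_ge0 => i _; rewrite mulr_ge0 ?normc_ge0 ?exprn_ge0// ltW.
rewrite -[leLHS]addr0 lerD//; last first.
  by apply: sumr_ge0 => i _; rewrite mulr_ge0 ?normc_ge0 ?exprn_ge0// ltW.
have -> : normc (a n) * r ^+ n = normc (psum a r%:C n.+1 - psum a r%:C n).
  rewrite /psum big_ord_recr/= addrAC subrr add0r normcM normcX normcR.
  by rewrite gtr0_norm.
apply: le_trans (normc_triB _ (h r%:C) _) _.
rewrite [X in _ + X]normcB (_ : 2 = 1 + 1)// lerD// ltW// HN//.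
exact: leq_trans Nn _.
Qed.

(** Boundedness at the midpoint s of r and 1 becomes decay at r, with ratio r / s. *)
Lemma radius_geo a : radius_ge1 a -> forall r, 0 < r < 1 ->
  exists B q, [/\ 0 <= B, 0 < q < 1 & forall n, normc (a n) * r ^+ n <= B * q ^+ n].
Proof.
move=> ga r /andP[r0 r1]; pose s := (1 + r) / 2.
have s0 : 0 < s by rewrite /s; lra.
have s1 : s < 1 by rewrite /s; lra.
have rs : r < s by rewrite /s; lra.
have [|B HB] := ga s; first by rewrite s0.
exists B, (r / s); split.
- by apply: le_trans (HB 0%N); rewrite mulr_ge0 ?normc_ge0 ?exprn_ge0// ltW.
- by rewrite divr_gt0//= ltr_pdivrMr// mul1r.
- move=> n; have {1}-> : r = s * (r / s) by rewrite mulrC divfK// gt_eqF.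
  rewrite exprMn mulrA ler_wpM2r// exprn_ge0// divr_ge0// ltW//.
Qed.

(** Bernoulli's inequality n d <= (1 + d)^n, with q = 1 / (1 + d). *)
Lemma nat_geo_bounded q : 0 < q < 1 -> forall n, n%:R * q ^+ n <= (q^-1 - 1)^-1.
Proof.
move=> /andP[q0 q1] n; set d := q^-1 - 1.
have d0 : 0 < d by rewrite subr_gt0 invf_gt1.
have bern : n%:R * d <= (1 + d) ^+ n.
  elim: n => [|n IH]; first by rewrite mul0r expr0.
  have h1 : 1 <= (1 + d) ^+ n by rewrite exprn_ege1// lerDl ltW.
  rewrite exprS -natr1; nra.
have qE : q = (1 + d)^-1 by rewrite /d addrC subrK invrK.
rewrite -(ler_pM2r d0) mulVf ?gt_eqF// qE exprVn mulrAC.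
by rewrite ler_pdivrMr ?mul1r// exprn_gt0// addr_gt0.
Qed.

Lemma radius_nat a : radius_ge1 a -> radius_ge1 (fun n => n%:R * a n).
Proof.
move=> ga r /(radius_geo ga)[B [q [B0 q01 HB]]].
exists (B * (q^-1 - 1)^-1) => n; rewrite normcM normc_nat -mulrA.
apply: le_trans (ler_wpM2l _ (HB n)) _ => //.
by rewrite mulrCA ler_wpM2l// nat_geo_bounded.
Qed.

Lemma radius_shift a : radius_ge1 a -> radius_ge1 (fun n => a n.+1).
Proof.
move=> ga r r01; have [B HB] := ga _ r01; exists (B / r) => n.
by rewrite ler_pdivlMr ?(andP r01).1// -mulrA -exprSr.
Qed.

Lemma radius_diff a : radius_ge1 a -> radius_ge1 (diff_coef a).
Proof. by move=> /radius_nat/radius_shift. Qed.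

Lemma radius_taylor a : radius_ge1 a -> exists h, taylor_on_disk h a.
Proof.
move=> ga; suff /choice[h Hh] : forall z, exists l : R[i], unit_disk z ->
  climit (psum a z) l by exists h; apply/taylorP.
move=> z; have [zd|] := pselect (unit_disk z); last by exists 0.
(* The centre is separate because geometric domination needs a positive radius. *)
have [->|z0] := eqVneq z 0.
  exists (a 0%N) => _ e e0; exists 1%N => n n0.
  rewrite (_ : psum a 0 n = a 0%N) ?subrr ?normc0// /psum; case: n n0 => // n _.
  rewrite big_ord_recl/= mulr1 big1 ?addr0// => i _.
  by rewrite expr0n /= mulr0.
have [|B [q [B0 /andP[q0 q1] HB]]] := radius_geo ga (r := normc z).
  by rewrite normc_gt0 z0.
have [|n|l Hl] := @climit_geo _ (fun n => a n * z ^+ n) B q.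
- by rewrite ltW.
- by rewrite normcM normcX.
by exists l.
Qed.

Lemma psum_tail a r B q z m n : 0 < r < 1 -> 0 < q < 1 ->
  (forall n, normc (a n) * r ^+ n <= B * q ^+ n) -> normc z <= r ->
  (m <= n)%N -> normc (psum a z n - psum a z m) <= B * q ^+ m / (1 - q).
Proof.
move=> /andP[r0 r1] /andP[q0 q1] HB zr mn.
have B0 : 0 <= B.
  have := HB 0%N; rewrite !expr0 !mulr1; exact: le_trans (normc_ge0 _).
rewrite /psum -[n](subnKC mn) big_split_ord /= addrAC subrr add0r.
apply: le_trans (normc_sum _ _ _) _.
apply: (@le_trans _ _ (\sum_(i < n - m) B * q ^+ m * q ^+ i)).
  apply: ler_sum => i _; rewrite normcM normcX -mulrA -exprD.
  apply: le_trans (HB _); rewrite ler_wpM2l ?normc_ge0//.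
  by rewrite lerXn2r// ?nnegrE ?normc_ge0// ltW.
rewrite -mulr_sumr ler_wpM2l ?mulr_ge0 ?exprn_ge0 ?(ltW q0)//.
by rewrite geo_sum_le// q1 ltW.
Qed.

(** The bound of [psum_tail] does not depend on z, so letting the longer partial sum converge keeps
    the estimate uniform. *)
Lemma taylor_tail h a r e : taylor_on_disk h a -> 0 < r < 1 -> 0 < e ->
  exists N, forall n z, (N <= n)%N -> normc z <= r -> normc (h z - psum a z n) <= e.
Proof.
move=> ha r01 e0.
have [B [q [B0 q01 HB]]] := radius_geo (taylor_radius ha) r01.
have [q0 q1] := andP q01; have q1' : 0 < 1 - q by rewrite subr_gt0.
have /cvgrPdist_lt/(_ e e0)[N _ HN] :
    (fun n => B / (1 - q) * q ^+ n) @ \oo --> (0 : R).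
  rewrite -[X in _ --> X](mulr0 (B / (1 - q))); apply: cvgMr.
  by apply: cvg_expr; rewrite gtr0_norm.
exists N => n z Nn zr.
have zd : unit_disk z by apply: le_lt_trans zr (andP r01).2.
have := climitB ((taylorP h a).1 ha z zd) (@climit_cst R (psum a z n)).
move=> /climit_le; apply; exists n => m nm.
apply: le_trans (psum_tail r01 q01 HB zr nm) _.
rewrite mulrAC; have /= := HN n Nn; rewrite sub0r normrN => /ltW.
by apply: le_trans; rewrite ler_norm.
Qed.

(** The term i = 0 is killed by its factor i, so the truncated exponent is harmless. The sum now has
    the index range of a partial sum of the original series, as termwise comparison requires. *)
Lemma psum_diff a z n : psum (diff_coef a) z n =
  \sum_(i < n.+1) a i * (i%:R * z ^+ i.-1).
Proof.
rewrite big_ord_recl/= mul0r mulr0 add0r; apply: eq_bigr => i _.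
by rewrite /diff_coef /bump /= add1n; ring.
Qed.

(** Induction: the remainder for n + 1 is w times the remainder for n plus n z^(n-1) (w - z)^2, and
    n^2 + n <= (n + 1)^2. The factor r^2 on the left avoids the exponent n - 2. *)
Lemma expr_taylor2 r z w n : 0 <= r -> normc z <= r -> normc w <= r ->
  normc (w ^+ n - z ^+ n - n%:R * z ^+ n.-1 * (w - z)) * r ^+ 2 <=
    n%:R ^+ 2 * r ^+ n * normc (w - z) ^+ 2.
Proof.
move=> r0 zr wr; elim: n => [|n IH].
  by rewrite !expr0 subrr !mul0r subrr normc0 expr0n/= !mul0r.
have -> : w ^+ n.+1 - z ^+ n.+1 - n.+1%:R * z ^+ n.+1.-1 * (w - z) =
    w * (w ^+ n - z ^+ n - n%:R * z ^+ n.-1 * (w - z)) +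
    n%:R * z ^+ n.-1 * (w - z) ^+ 2.
  case: n {IH} => [|n]; first by rewrite /= !expr0 expr1; ring.
  by rewrite /= !exprS -!natr1; ring.
set e := (X in w * X); set d := normc (w - z).
have d0 : 0 <= d by exact: normc_ge0.
have h1 : normc (w * e) * r ^+ 2 <= r * (n%:R ^+ 2 * r ^+ n * d ^+ 2).
  rewrite normcM -mulrA ler_pM// ?normc_ge0// mulr_ge0 ?normc_ge0//.
  by rewrite exprn_ge0.
have h2 : normc (n%:R * z ^+ n.-1 * (w - z) ^+ 2) * r ^+ 2 <=
    n%:R * r ^+ n.+1 * d ^+ 2.
  case: n {IH e h1} => [|n].
    by rewrite mul0r mul0r mul0r normc0 !mul0r.
  rewrite normcM (normcX _ 2) normcM normc_nat (normcX z) succnK mulrAC.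
  apply: ler_wpM2r; first exact: exprn_ge0.
  rewrite -mulrA ler_wpM2l// -[n.+2]addn2 exprD.
  by rewrite ler_wpM2r ?exprn_ge0// lerXn2r ?nnegrE ?normc_ge0.
apply: (@le_trans _ _ (r * (n%:R ^+ 2 * r ^+ n * d ^+ 2) + n%:R * r ^+ n.+1 * d ^+ 2)).
  apply: le_trans (lerD h1 h2).
  by rewrite -mulrDl ler_wpM2r ?exprn_ge0// le_normcD.
rewrite (_ : r * _ = n%:R ^+ 2 * r ^+ n.+1 * d ^+ 2); last by rewrite (exprS r n); ring.
rewrite -!mulrDl ler_wpM2r ?exprn_ge0 ?normc_ge0// ler_wpM2r ?exprn_ge0//.
rewrite -natr1; have : 0 <= n%:R :> R by []; move: (n%:R : R) => x x0; nra.
Qed.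

(** The factor n^2 of [expr_taylor2] is absorbed by applying [radius_nat] twice; the remainders are
    then summed geometrically and the bound passes to the limit. *)
Lemma taylor_diff h k a r : taylor_on_disk h a -> taylor_on_disk k (diff_coef a) ->
  0 < r < 1 -> exists2 C, 0 <= C & forall z w, normc z <= r -> normc w <= r ->
    normc (h w - h z - k z * (w - z)) <= C * normc (w - z) ^+ 2.
Proof.
move=> ha ka r01; have [r0 r1] := andP r01.
have [B [q [B0 q01 HB]]] := radius_geo (radius_nat (radius_nat (taylor_radius ha))) r01.
have [q0 q1] := andP q01.
exists (B / (1 - q) / r ^+ 2) => [|z w zr wr].
  by rewrite !divr_ge0 ?exprn_ge0 ?(ltW r0)// subr_ge0 ltW.
have zd : unit_disk z by apply: le_lt_trans zr r1.
have wd : unit_disk w by apply: le_lt_trans wr r1.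
have hz := climit_shift 1 ((taylorP h a).1 ha z zd).
have hw := climit_shift 1 ((taylorP h a).1 ha w wd).
have kz := climitZ (w - z) ((taylorP _ _).1 ka z zd).
have := climitB (climitB hw hz) kz; rewrite [k z * _]mulrC.
move=> /climit_le; apply; exists 0%N => n _.
rewrite addn1 psum_diff /psum mulr_sumr -!sumrB.
rewrite mulrAC ler_pdivlMr ?exprn_gt0//.
apply: (@le_trans _ _ (\sum_(i < n.+1) B * q ^+ i * normc (w - z) ^+ 2)); last first.
  rewrite -mulr_suml ler_wpM2r ?exprn_ge0 ?normc_ge0//.
  by rewrite -mulr_sumr ler_wpM2l// geo_sum_le// ltW.
apply: (@le_trans _ _ (\sum_(i < n.+1) normc (a i) *
    (normc (w ^+ i - z ^+ i - i%:R * z ^+ i.-1 * (w - z)) * r ^+ 2))).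
  under [leRHS]eq_bigr do rewrite mulrA.
  rewrite -mulr_suml ler_wpM2r ?exprn_ge0 ?(ltW r0)//.
  apply: le_trans (normc_sum _ _ _) _; apply: ler_sum => i _.
  by rewrite -normcM le_eqVlt; apply/orP; left; apply/eqP; congr normc; ring.
apply: ler_sum => i _.
apply: le_trans (ler_wpM2l (normc_ge0 _) (expr_taylor2 i (ltW r0) zr wr)) _.
have := HB i; rewrite !normcM normc_nat.
move=> /(ler_wpM2r (exprn_ge0 2 (normc_ge0 (w - z)))); apply: le_trans.
by rewrite le_eqVlt; apply/orP; left; apply/eqP; ring.
Qed.

Lemma taylor_bounded h a r : taylor_on_disk h a -> 0 < r < 1 ->
  exists2 B, 0 <= B & forall z, normc z <= r -> normc (h z) <= B.
Proof.
move=> ha r01; have [B [q [B0 q01 HB]]] := radius_geo (taylor_radius ha) r01.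
have [q0 q1] := andP q01.
exists (B / (1 - q)) => [|z zr]; first by rewrite divr_ge0// subr_ge0 ltW.
have zd : unit_disk z by apply: le_lt_trans zr (andP r01).2.
apply: (climit_le ((taylorP h a).1 ha z zd)); exists 0%N => n _.
have := psum_tail r01 q01 HB zr (leq0n n).
by rewrite {2}/psum big_ord0 subr0 expr0 mulr1.
Qed.

Lemma taylor_lipschitz h a r : taylor_on_disk h a -> 0 < r < 1 ->
  exists2 L, 0 <= L & forall z w, normc z <= r -> normc w <= r ->
    normc (h w - h z) <= L * normc (w - z).
Proof.
move=> ha r01.
have [k ka] := radius_taylor (radius_diff (taylor_radius ha)).
have [C C0 HC] := taylor_diff ha ka r01.
have [D D0 HD] := taylor_bounded ka r01.
(* D bounds the derivative, and the quadratic remainder is linear up to the factor |w - z| <= 2. *)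
exists (C * 2 + D) => [|z w zr wr]; first by rewrite addr_ge0// mulr_ge0.
rewrite -[h w - h z](subrK (k z * (w - z))) mulrDl.
apply: le_trans (le_normcD _ _) (lerD _ _); last first.
  by rewrite normcM ler_wpM2r ?normc_ge0// HD.
apply: le_trans (HC _ _ zr wr) _.
rewrite expr2 mulrA ler_wpM2r ?normc_ge0// ler_wpM2l//.
by apply: le_trans (le_normcB _ _) _; move: (andP r01).2; lra.
Qed.

Lemma taylorD h k a b : taylor_on_disk h a -> taylor_on_disk k b ->
  taylor_on_disk (fun z => h z + k z) (fun n => a n + b n).
Proof.
move=> /taylorP ha /taylorP kb; apply/taylorP => z zd.
apply: climit_eq (climitD (ha z zd) (kb z zd)) => n.
by rewrite /psum -big_split; apply: eq_bigr => i _; rewrite mulrDl.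
Qed.

Lemma taylorZ h a c : taylor_on_disk h a ->
  taylor_on_disk (fun z => c * h z) (fun n => c * a n).
Proof.
move=> /taylorP ha; apply/taylorP => z zd.
apply: climit_eq (climitZ c (ha z zd)) => n.
by rewrite /psum mulr_sumr; apply: eq_bigr => i _; rewrite mulrA.
Qed.

Lemma taylor0 h a : taylor_on_disk h a -> h 0 = a 0%N.
Proof.
move=> /taylorP/(_ 0 (@unit_disk0 R)) h0; apply: climit_uniq h0 _.
move=> e e0; exists 1%N => -[//|n] _.
rewrite /psum big_ord_recl/= mulr1 big1 ?addr0 ?subrr ?normc0// => i _.
by rewrite expr0n/= mulr0.
Qed.

End PowerSeries.

(** * A Schwarz-Pick bound for coefficients *)

Section CoefficientBound.
Variable R : realType.
Implicit Types (t B M : R) (c : nat -> R[i]).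

Lemma normc_cis t : normc (cis t) = 1.
Proof. by rewrite /normc /cis cos2Dsin2 sqrtr1. Qed.

Lemma cisD t s : cis (t + s) = cis t * cis s.
Proof.
apply/eqP; rewrite eq_complex /cis /= cosD sinD.
by apply/andP; split; apply/eqP; ring.
Qed.

Lemma cis0 : cis (0 : R) = 1.
Proof. by rewrite /cis cos0 sin0. Qed.

Lemma cisX t n : cis t ^+ n = cis (n%:R * t).
Proof.
elim: n => [|n IH]; first by rewrite expr0 mul0r cis0.
by rewrite exprS IH -cisD -nat1r mulrDl mul1r.
Qed.

Lemma cis_neq1 t : 0 < t < 2 * pi -> cis t != 1.
Proof.
move=> /andP[t0 t1]; rewrite eq_complex /= negb_and.
have s0 : 0 < sin (t / 2) by apply: sin_gt0_pi; apply/andP; split; lra.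
have -> : cos t = 1 - 2 * sin (t / 2) ^+ 2.
  by rewrite [in LHS](splitr t) cosD -!expr2 cos2sin2; ring.
by apply/orP; left; rewrite lt_eqF// ltrBlDr ltrDl mulr_gt0// exprn_gt0.
Qed.

(** * Orthogonality of powers of roots of unity *)

Section RootsOfUnity.
Variable N : nat.
Hypothesis N0 : (0 < N)%N.

Definition unity_root := cis (2 * pi / N%:R : R).
Local Notation w := unity_root.

Lemma unity_rootN : w ^+ N = 1.
Proof.
rewrite /w cisX mulrCA divff ?mulr1 ?pnatr_eq0 -?lt0n//.
by rewrite mulr_natl /cis cos2pi sin2pi.
Qed.

Lemma normc_unity_root m : normc (w ^+ m) = 1.
Proof. by rewrite normcX normc_cis expr1n. Qed.

(** A geometric sum of ratio w^m: multiplied by w^m - 1 it telescopes to 0, and w^m != 1 because its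
    angle lies strictly between 0 and 2 pi. *)
Lemma unity_root_sum0 m : (0 < m < N)%N -> \sum_(j < N) (w ^+ j) ^+ m = 0.
Proof.
move=> /andP[m0 mN]; set S := (X in X = 0).
have : (w ^+ m - 1) * S = 0.
  rewrite /S; under eq_bigr do rewrite -exprM mulnC exprM.
  by rewrite -subrX1 -exprM mulnC exprM unity_rootN expr1n subrr.
move/eqP; rewrite mulf_eq0 subr_eq0 => /orP[|/eqP//]; rewrite cisX.
have N0' : 0 < N%:R :> R by rewrite ltr0n.
rewrite (negPf (cis_neq1 _))// !mulrA divr_gt0 ?mulr_gt0 ?ltr0n ?pi_gt0//=.
rewrite ltr_pdivrMr// -mulrA [_ * N%:R]mulrC ltr_pM2r ?mulr_gt0 ?pi_gt0//.
by rewrite ltr_nat.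
Qed.

Lemma unity_root_sum m : (0 < m < N + N)%N -> m != N ->
  \sum_(j < N) (w ^+ j) ^+ m = 0.
Proof.
move=> /andP[m0 mNN] mN; have [mlN|Nlm] := ltnP m N.
  by apply: unity_root_sum0; rewrite m0.
rewrite -(subnK Nlm); under eq_bigr do
  rewrite exprD -[_ ^+ N]exprM mulnC exprM unity_rootN expr1n mulr1.
by apply: unity_root_sum0; rewrite subn_gt0 ltn_neqAle eq_sym mN Nlm ltn_subLR.
Qed.

End RootsOfUnity.

(* Average [P * T] over the [N]-th roots of unity, with the test function
   [T(w) = w^-k * (1 + al * w^k)^2], of modulus [|1 + al * w^k|^2]. *)
Lemma poly_coef_bound c L k al B : (0 < k < L)%N ->
  (forall w, normc w = 1 -> normc (psum c w L) <= B) ->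
  normc (c k + 2 * al * c 0%N) <= B * (1 + normc al ^+ 2).
Proof.
(* On N-th roots of unity w^-k is w^(N - k). With N = L + k and i < L there is no aliasing: i + (N -
   k) is below 2N and equals N only for i = k, i + 0 is a multiple of N only for i = 0, and i + k
   stays strictly between 0 and N. *)
move=> /andP[k0 kL] cB; pose N := (L + k)%N.
have kN : (k < N)%N by rewrite /N -[k in (k < _)%N]add0n ltn_add2r (leq_trans _ kL).
have LN : (L <= N)%N by rewrite leq_addr.
have N0 : (0 < N)%N by exact: leq_trans kN.
pose w := unity_root N.
have wN j : (w ^+ j) ^+ N = 1 by rewrite -exprM mulnC exprM unity_rootN// expr1n.
have w1 j : normc (w ^+ j) = 1 by exact: normc_unity_root.
have kNk : (N - k + k = N)%N by rewrite subnK// ltnW.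
pose T u : R[i] := u ^+ (N - k) * (1 + al * u ^+ k) ^+ 2.
have TE j : T (w ^+ j) = (w ^+ j) ^+ (N - k) + 2 * al * (w ^+ j) ^+ 0
    + al ^+ 2 * (w ^+ j) ^+ k.
  rewrite /T; have h : (w ^+ j) ^+ (N - k) * (w ^+ j) ^+ k = 1.
    by rewrite -exprD kNk.
  set u := _ ^+ (N - k) in h *; set v := _ ^+ k in h *.
  transitivity (u + 2 * al * (u * v) + al ^+ 2 * v * (u * v)); first by ring.
  by rewrite h expr0 !mulr1.
have sumE m : \sum_(j < N) psum c (w ^+ j) L * (w ^+ j) ^+ m =
    \sum_(i < L) c i * \sum_(j < N) (w ^+ j) ^+ (i + m).
  under eq_bigr do rewrite /psum mulr_suml.
  rewrite exchange_big /=; apply: eq_bigr => i _; rewrite mulr_sumr.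
  by apply: eq_bigr => j _; rewrite exprD mulrA.
have sumT : \sum_(j < N) psum c (w ^+ j) L * T (w ^+ j) =
    N%:R * (c k + 2 * al * c 0%N).
  have sumN m : (forall j, (w ^+ j) ^+ m = 1) -> \sum_(j < N) (w ^+ j) ^+ m = N%:R.
    move=> h; under eq_bigr do rewrite h.
    by rewrite sumr_const card_ord.
  transitivity (\sum_(i < L) c i * (\sum_(j < N) (w ^+ j) ^+ (i + (N - k))) +
     2 * al * (\sum_(i < L) c i * (\sum_(j < N) (w ^+ j) ^+ (i + 0))) +
     al ^+ 2 * (\sum_(i < L) c i * (\sum_(j < N) (w ^+ j) ^+ (i + k)))).
    rewrite -!sumE !mulr_sumr -!big_split; apply: eq_bigr => j _ /=.
    by rewrite TE; ring.
  rewrite (bigD1 (Ordinal kL))//= [(k + _)%N]addnC kNk (sumN N)//.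
  rewrite big1 => [|i ik]; last first.
    rewrite unity_root_sum ?mulr0//.
      have iL := ltn_ord i.
      rewrite addn_gt0 subn_gt0 kN orbT/=.
      by rewrite -addSn leq_add ?leq_subr// (leq_trans iL).
    apply: contra ik => /eqP; rewrite -[X in _ = X]kNk addnC => /addnI h.
    exact/eqP/val_inj.
  have L0 : (0 < L)%N by exact: leq_trans kL.
  rewrite (bigD1 (Ordinal L0))//= (sumN (0 + 0)%N)//.
  rewrite big1 => [|i i0]; last first.
    rewrite addn0 unity_root_sum0 ?mulr0//.
    by rewrite lt0n (leq_trans (ltn_ord i))// andbT; apply: contra i0 => /eqP h; apply/eqP/val_inj.
  rewrite big1 => [|i _]; last first.
    rewrite unity_root_sum0 ?mulr0//.
    by rewrite addn_gt0 k0 orbT /= ltn_add2r.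
  by ring.
(* The two cross terms of |1 + al u^k|^2 average to 0, since k and N - k both lie strictly between 0
   and N. *)
have sumB : \sum_(j < N) normc (T (w ^+ j)) = N%:R * (1 + normc al ^+ 2).
  apply: (@complexI R); rewrite rmorph_sum rmorphM rmorph_nat (rmorphD _ 1) /= -mulcJ.
  transitivity (\sum_(j < N) (1 + al * al^*) + al * (\sum_(j < N) (w ^+ j) ^+ k)
    + al^* * (\sum_(j < N) (w ^+ j) ^+ (N - k))).
    rewrite !mulr_sumr -!big_split; apply: eq_bigr => j _ /=.
    rewrite /T normcM normcX w1 expr1n mul1r normcX.
    have -> x : (normc (1 + al * x) ^+ 2)%:C = (1 + al * x) * (1 + al^* * x^*).
      by rewrite -mulcJ rmorphD rmorphM rmorph1.
    have -> : ((w ^+ j) ^+ k)^* = (w ^+ j) ^+ (N - k).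
      have u0 : (w ^+ j) ^+ k != 0 by rewrite -normc_eq0 normcX w1 expr1n oner_eq0.
      apply: (mulfI u0); rewrite mulcJ normcX w1 !expr1n rmorph1.
      by rewrite -exprD addnC kNk.
    have h : (w ^+ j) ^+ (N - k) * (w ^+ j) ^+ k = 1 by rewrite -exprD kNk.
    set u := _ ^+ (N - k) in h *; set v := _ ^+ k in h *.
    have -> : 1 + al * al^* = 1 + al * al^* * (u * v) by rewrite h mulr1.
    by ring.
  rewrite !unity_root_sum0 ?mulr0 ?addr0 ?k0//.
    by rewrite sumr_const card_ord mulr_natl.
  by rewrite subn_gt0 kN -[X in (_ < X)%N]subn0 ltn_sub2l.
have N0' : 0 < N%:R :> R by rewrite ltr0n.
rewrite -(ler_pM2l N0') mulrCA -sumB mulr_sumr.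
have -> : N%:R * normc (c k + 2 * al * c 0%N) = normc (N%:R * (c k + 2 * al * c 0%N)).
  by rewrite normcM normc_nat.
rewrite -sumT; apply: le_trans (normc_sum _ _ _) _.
apply: ler_sum => j _; rewrite normcM ler_wpM2r ?normc_ge0//.
by rewrite cB.
Qed.

(** F is controlled on the open disk only, so the polynomial bound is applied to long Taylor
    polynomials of F(r z): these are at most M + e on the unit circle, for every e > 0. *)
Lemma taylor_coef_bound (F : R[i] -> R[i]) c M k al r : taylor_on_disk F c ->
  (forall z, unit_disk z -> normc (F z) <= M) -> (0 < k)%N -> 0 < r < 1 ->
  normc (c k * r%:C ^+ k + 2 * al * c 0%N) <= M * (1 + normc al ^+ 2).
Proof.
move=> Fc FM k0 r01; have [r0 r1] := andP r01.
have D0 : 0 < 1 + normc al ^+ 2 by rewrite ltr_wpDr ?exprn_ge0 ?normc_ge0.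
rewrite -ler_pdivrMr//; apply/ler_addgt0Pr => e e0; rewrite ler_pdivrMr//.
have [N HN] := taylor_tail Fc r01 e0.
(* Long enough both for the tail estimate and for containing the coefficient of index k. *)
pose L := maxn N k.+1.
have := @poly_coef_bound (fun n => c n * r%:C ^+ n) L k al (M + e).
rewrite expr0 mulr1; apply; first by rewrite k0 leq_maxr.
move=> w w1; have wr : normc (r%:C * w) <= r by rewrite normcM normcR w1 mulr1 gtr0_norm.
have -> : psum (fun n => c n * r%:C ^+ n) w L = psum c (r%:C * w) L.
  by apply: eq_bigr => i _; rewrite exprMn mulrA.
rewrite -[psum _ _ _](subrK (F (r%:C * w))) addrC.
apply: le_trans (le_normcD _ _) (lerD _ _).
  by apply: FM; exact: le_lt_trans r1.
by rewrite normcB HN// leq_maxl.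
Qed.

Lemma le_lim_expr (x y : R) k : 0 <= x ->
  (forall r, 0 < r < 1 -> x * r ^+ k <= y) -> x <= y.
Proof.
move=> x0 H.
have bern (d : R) : 0 <= d <= 1 -> 1 - k%:R * d <= (1 - d) ^+ k.
  move=> /andP[d0 d1]; elim: k {H} => [|k IH]; first by rewrite mul0r subr0.
  have h : 0 <= (1 - d) ^+ k by rewrite exprn_ge0// subr_ge0.
  have k0 : 0 <= k%:R :> R by [].
  by rewrite exprS -natr1; move: ((1 - d) ^+ k) (k%:R : R) h k0 IH => u v; nra.
apply/ler_addgt0Pr => e e0.
have kx0 : 0 <= k%:R * x by rewrite mulr_ge0.
(* Chosen so that d <= 1/2 and the Bernoulli loss d k x stays below e. *)
pose d := e / (2 * (k%:R * x + e)).
have d0 : 0 < d by rewrite divr_gt0// mulr_gt0// ltr_wpDl.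
have dE : d * (2 * (k%:R * x + e)) = e.
  by rewrite divfK// gt_eqF// mulr_gt0// ltr_wpDl.
have d1 : d < 1 by move: (k%:R * x) kx0 dE => u; nra.
have := H (1 - d); rewrite subr_gt0 d1 gtrBl d0 => /(_ isT).
have := bern d; rewrite (ltW d0) (ltW d1) => /(_ isT) /(ler_wpM2l x0) h1 h2.
have de0 : 0 < d * e by rewrite mulr_gt0.
rewrite (le_trans (y := x * (1 - k%:R * d) + e))//; last by rewrite lerD2r (le_trans h1).
have -> : x * (1 - k%:R * d) = x - d * (k%:R * x) by ring.
lra.
Qed.

Lemma schwarz_pick_coef (F : R[i] -> R[i]) c M k : taylor_on_disk F c -> 0 < M ->
  (forall z, unit_disk z -> normc (F z) <= M) -> (0 < k)%N ->
  normc (c k) <= M - normc (c 0%N) ^+ 2 / M.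
Proof.
move=> Fc M0 FM k0; apply: (@le_lim_expr _ _ k); first exact: normc_ge0.
move=> r r01.
(* The parameter will be al = d * a0^* / M: its modulus minimizes M (1 + |al|^2) - 2 |al| |a0|, and
   d makes the moduli of the two terms add. *)
pose a0 := c 0%N; have [d d1 dE] := align (c k * r%:C ^+ k) (2 * a0^* / M%:C * a0).
have nM : normc (M%:C : R[i]) = M by rewrite normcR gtr0_norm.
have := @taylor_coef_bound F c M k (d * a0^* / M%:C) r Fc FM k0 r01.
rewrite -/a0 (_ : 2 * (d * a0^* / M%:C) * a0 = d * (2 * a0^* / M%:C * a0)); last by ring.
rewrite dE !normcM !normcV d1 mul1r normc_conj nM normcX normc_nat normcR.
rewrite gtr0_norm ?(andP r01).1//.
set x := normc (c k) * _; set y := normc a0 => h.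
rewrite lerBrDr -(lerD2r (y ^+ 2 / M)).
have -> : M + y ^+ 2 / M = M * (1 + (y / M) ^+ 2) by field; rewrite gt_eqF.
by apply: le_trans h; rewrite -addrA lerD2l le_eqVlt; apply/orP; left; apply/eqP; ring.
Qed.

End CoefficientBound.

(** * Real differentiation of complex maps *)

Section Differentiation.
Variable R : realType.
Implicit Types (f g h k : R[i] -> R[i]) (z w p q : R[i]).

Lemma continuousC f z : {for z, continuous (f : R[i]^o -> R[i]^o)} <->
  forall e : R, 0 < e -> exists2 d : R, 0 < d &
    forall w, normc (w - z) < d -> normc (f w - f z) < e.
Proof.
split=> [fz e e0|H].
  have e0' : 0 < e%:C by rewrite -(rmorph0 (real_complex R)) ltcR.
  have /cvgrPdist_lt/(_ _ e0')/nbhs_normP[/= d d0 Hd] := fz.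
  have [d1 d1E] : exists d1 : R, d = d1%:C.
    by apply/complex_realP; rewrite realE ltW.
  move: d0; rewrite d1E -(rmorph0 (real_complex R)) ltcR => d0.
  exists d1 => // w wz; have := Hd w.
  rewrite /= d1E normr_normc ltcR (normcB z) => /(_ wz).
  by rewrite normr_normc ltcR normcB.
have FF : Filter (nbhs (z : R[i]^o)) by exact: nbhs_filter.
have := @cvgrPdist_lt R[i] R[i]^o R[i]^o (nbhs (z : R[i]^o)) FF f (f z).
move=> [_]; apply => e e0.
have [e1 e1E] : exists e1 : R, e = e1%:C.
  by apply/complex_realP; rewrite realE ltW.
have [|d d0 Hd] := H e1.
  by move: e0; rewrite e1E -(rmorph0 (real_complex R)) ltcR.
have nP := @nbhs_normP R[i] R[i]^o z (fun t => `|f z - f t| < e).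
apply/nP; exists d%:C => /=.
  by rewrite -(rmorph0 (real_complex R)) ltcR.
move=> w /=; rewrite normr_normc ltcR normcB => /Hd.
by rewrite e1E normr_normc ltcR normcB.
Qed.

Lemma is_derive_eps (phi : R -> R) (x d : R) :
  (forall e, 0 < e -> exists2 del : R, 0 < del &
    forall t, `|t| < del -> `|phi (t + x) - phi x - d * t| <= e * `|t|) ->
  is_derive x 1 phi d.
Proof.
move=> H.
have cv : (fun t => t^-1 *: ((phi \o shift x) (t *: 1) - phi x)) @ 0^' --> d.
  apply/cvgrPdist_le => e e0; have [del del0 Hd] := H e e0.
  apply/nbhs_normP; exists del => //= t /=; rewrite sub0r normrN => td t0.
  have nt0 : 0 < `|t| by rewrite normr_gt0.
  have := Hd t td; rewrite -ler_pdivrMr// -normfV -normrM => h.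
  rewrite distrC; apply: le_trans h; rewrite le_eqVlt; apply/orP; left.
  apply/eqP; congr (`| _ |); rewrite /= [t *: 1]mulr1 /GRing.scale /=.
  by field.
by apply: DeriveDef; [apply/cvg_ex; exists d|apply/cvg_lim].
Qed.

Lemma is_derive_derive1 (phi : R -> R) (x d : R) : is_derive x 1 phi d -> derive1 phi x = d.
Proof. by move=> h; rewrite derive1E derive_val. Qed.

(** Total real differentiability in Wirtinger form: p and q turn out to be f_z and f_zbar. *)
Definition rdiff f z p q := forall e : R, 0 < e -> exists2 d : R, 0 < d &
  forall w, normc (w - z) < d ->
    normc (f w - f z - p * (w - z) - q * (w - z)^*) <= e * normc (w - z).

Lemma rdiffD f g z p q p' q' : rdiff f z p q -> rdiff g z p' q' ->
  rdiff (fun w => f w + g w) z (p + p') (q + q').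
Proof.
move=> fz gz e e0; have e2 : 0 < e / 2 by rewrite divr_gt0.
have [d d0 Hd] := fz _ e2; have [d' d0' Hd'] := gz _ e2.
exists (Num.min d d'); first by rewrite lt_min d0.
move=> w; rewrite lt_min => /andP[/Hd h1 /Hd' h2].
rewrite [e]splitr [leRHS]mulrDl; apply: le_trans (lerD h1 h2).
by apply: le_trans (le_normcD _ _); rewrite le_eqVlt; apply/orP; left; apply/eqP; congr normc; ring.
Qed.

Lemma rdiffJ f z p q : rdiff f z p q -> rdiff (fun w => (f w)^*) z q^* p^*.
Proof.
move=> fz e /fz[d d0 Hd]; exists d => // w /Hd; apply: le_trans; rewrite le_eqVlt; apply/orP; left; apply/eqP.
by rewrite -[RHS]normc_conj !(conjB, conjM) !conjK; congr normc; ring.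
Qed.

(** Functions are unconstrained off the disk, so the neighbourhood is shrunk to stay inside it. *)
Lemma rdiff_eq f g z p q : unit_disk z -> (forall w, unit_disk w -> f w = g w) ->
  rdiff f z p q -> rdiff g z p q.
Proof.
move=> zd fg fz e /fz[d d0 Hd]; exists (Num.min d (1 - normc z)).
  by rewrite lt_min d0 subr_gt0.
move=> w; rewrite lt_min => /andP[wd wz]; rewrite -!fg//; first exact: Hd.
rewrite /unit_disk/= -[w](subrK z); apply: le_lt_trans (le_normcD _ _) _.
by rewrite -ltrBrDr.
Qed.

Lemma taylor_rdiff h k a z : taylor_on_disk h a -> taylor_on_disk k (diff_coef a) ->
  unit_disk z -> rdiff h z (k z) 0.
Proof.
move=> ha ka zd e e0; pose r := (1 + normc z) / 2.
have nz := normc_ge0 z; have zd' : normc z < 1 by [].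
have r01 : 0 < r < 1 by apply/andP; split; rewrite /r; lra.
have [C C0 HC] := taylor_diff ha ka r01.
have C1 : 0 < C + 1 by rewrite ltr_wpDl.
exists (Num.min (r - normc z) (e / (C + 1))).
  by rewrite lt_min divr_gt0// andbT /r; lra.
move=> w; rewrite lt_min => /andP[w1 w2]; rewrite mul0r subr0.
have zr : normc z <= r by rewrite /r; lra.
apply: le_trans (HC _ _ zr _) _.
  rewrite -[w](subrK z); apply: le_trans (le_normcD _ _) _.
  by rewrite -lerBrDr ltW.
rewrite expr2 mulrA ler_wpM2r ?normc_ge0//.
move: w2; rewrite ltr_pdivlMr//; have := normc_ge0 (w - z); nra.
Qed.

Lemma rdiff_dir f z p q (u : R[i]) : rdiff f z p q -> normc u = 1 ->
  forall e : R, 0 < e -> exists2 d : R, 0 < d & forall t : R, `|t| < d ->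
    normc (f (t%:C * u + z) - f z - (p * u + q * u^*) * t%:C) <= e * `|t|.
Proof.
move=> fz u1 e /fz[d d0 Hd]; exists d => // t td.
have := Hd (t%:C * u + z); rewrite addrK normcM normcR u1 mulr1 => /(_ td).
apply: le_trans; rewrite le_eqVlt; apply/orP; left; apply/eqP; congr normc.
have -> : (t%:C * u)^* = t%:C * u^*.
  by rewrite conjM conjR.
by ring.
Qed.

Section Partials.
Variables (f : R[i] -> R[i]) (z p q : R[i]).
Hypothesis fz : rdiff f z p q.

(** Covers all four partials: u is 1 or i, and pr is the real or the imaginary part. *)
Let part (u : R[i]) (pr : R[i] -> R) (phi : R -> R) (x : R) : normc u = 1 ->
  (forall v, `|pr v| <= normc v) -> (forall v w, pr (v - w) = pr v - pr w) ->
  (forall v (t : R), pr (v * t%:C) = pr v * t) ->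
  (forall t, phi (t + x) = pr (f (t%:C * u + z))) ->
  is_derive x 1 phi (pr (p * u + q * u^*)).
Proof.
move=> u1 prn prB prZ phiE; apply: is_derive_eps => e e0.
have [d d0 Hd] := rdiff_dir fz u1 e0; exists d => // t /Hd.
apply: le_trans; rewrite phiE -[x]add0r phiE mul0r add0r -prZ -!prB.
exact: prn.
Qed.

Let ReZ (v : R[i]) (t : R) : complex.Re (v * t%:C) = complex.Re v * t.
Proof. by case: v => a b /=; ring. Qed.
Let ImZ (v : R[i]) (t : R) : complex.Im (v * t%:C) = complex.Im v * t.
Proof. by case: v => a b /=; ring. Qed.

Let zx (t : R) : (t + complex.Re z) +i* complex.Im z = t%:C * 1 + z.
Proof. by rewrite mulr1; case: z => a b; apply/eqP; rewrite eq_complex /= add0r !eqxx. Qed.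
Let zy (t : R) : complex.Re z +i* (t + complex.Im z) = t%:C * 'i%C + z.
Proof.
by case: z => a b; apply/eqP; rewrite eq_complex /= !mul0r mulr0 mulr1 subr0 !add0r addr0 !eqxx.
Qed.
Let ni : normc ('i%C : R[i]) = 1.
Proof. by rewrite /normc expr0n /= add0r expr1n sqrtr1. Qed.
Let conji : ('i%C : R[i])^* = - 'i%C.
Proof. by apply/eqP; rewrite eq_complex /= oppr0 !eqxx. Qed.

Lemma rdiff_Re_x : is_derive (complex.Re z) 1
  (fun x : R => complex.Re (f (x +i* complex.Im z))) (complex.Re (p + q)).
Proof.
have := @part 1 (@complex.Re R) (fun x => complex.Re (f (x +i* complex.Im z))) (complex.Re z).
rewrite conjC1 !mulr1; apply=> //; first exact: normc1.
- exact: Re_le_normc.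
- exact: ReB.
- by move=> t; rewrite zx.
Qed.

Lemma rdiff_Im_x : is_derive (complex.Re z) 1
  (fun x : R => complex.Im (f (x +i* complex.Im z))) (complex.Im (p + q)).
Proof.
have := @part 1 (@complex.Im R) (fun x => complex.Im (f (x +i* complex.Im z))) (complex.Re z).
rewrite conjC1 !mulr1; apply=> //; first exact: normc1.
- exact: Im_le_normc.
- exact: ImB.
- by move=> t; rewrite zx.
Qed.

Let yE : p * 'i%C + q * ('i%C)^* = 'i%C * (p - q).
Proof. by rewrite conji; ring. Qed.

Lemma rdiff_Re_y : is_derive (complex.Im z) 1
  (fun y : R => complex.Re (f (complex.Re z +i* y))) (complex.Re ('i%C * (p - q))).
Proof.
rewrite -yE; apply: part ni _ _ ReZ _; first exact: Re_le_normc.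
- exact: ReB.
- by move=> t; rewrite zy.
Qed.

Lemma rdiff_Im_y : is_derive (complex.Im z) 1
  (fun y : R => complex.Im (f (complex.Re z +i* y))) (complex.Im ('i%C * (p - q))).
Proof.
rewrite -yE; apply: part ni _ _ ImZ _; first exact: Im_le_normc.
- exact: ImB.
- by move=> t; rewrite zy.
Qed.

Lemma rdiff_dx : dx f z = p + q.
Proof.
rewrite /dx (is_derive_derive1 rdiff_Re_x) (is_derive_derive1 rdiff_Im_x).
by case: (p + q).
Qed.

Lemma rdiff_dy : dy f z = 'i%C * (p - q).
Proof.
rewrite /dy (is_derive_derive1 rdiff_Re_y) (is_derive_derive1 rdiff_Im_y).
by case: ('i%C * _).
Qed.

Lemma rdiff_dz : dz f z = p.
Proof.
rewrite /dz rdiff_dx rdiff_dy -complexiE mulrA -expr2 sqr_i.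
by field.
Qed.

Lemma rdiff_dzbar : dzbar f z = q.
Proof.
rewrite /dzbar rdiff_dx rdiff_dy -complexiE mulrA -expr2 sqr_i.
by field.
Qed.

End Partials.

Lemma taylor_continuous h a : taylor_on_disk h a -> continuous_on_disk h.
Proof.
move=> ha z zd; apply/continuousC => e e0; pose r := (1 + normc z) / 2.
have nz := normc_ge0 z; have zd' : normc z < 1 by [].
have r01 : 0 < r < 1 by apply/andP; split; rewrite /r; lra.
have [L L0 HL] := taylor_lipschitz ha r01.
have L1 : 0 < L + 1 by rewrite ltr_wpDl.
exists (Num.min (r - normc z) (e / (L + 1))).
  by rewrite lt_min divr_gt0// andbT /r; lra.
move=> w; rewrite lt_min => /andP[w1 w2].
have zr : normc z <= r by rewrite /r; lra.
apply: le_lt_trans (HL _ _ zr _) _.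
  rewrite -[w](subrK z); apply: le_trans (le_normcD _ _) _.
  by rewrite -lerBrDr ltW.
move: w2; rewrite ltr_pdivlMr//; have := normc_ge0 (w - z); nra.
Qed.

End Differentiation.

(** * The coefficient bound for elliptic harmonic maps *)

Section EllipticBound.
Variable R : realType.
Implicit Types (f g h : R[i] -> R[i]) (z w u : R[i]).

(** A purely algebraic identity in [dx f z] and [dy f z], valid whether or not f is differentiable
    at z. *)
Lemma formal_differentialE f z u :
  mx_act (formal_differential f z) u = dz f z * u + dzbar f z * u^*.
Proof.
rewrite /dz /dzbar -complexiE.
set a := dx f z; set b := dy f z.
have -> : 2^-1 * (a - 'i%C * b) * u + 2^-1 * (a + 'i%C * b) * u^* =
    a * ((u + u^*) / 2) - b * ('i%C * (u - u^*) / 2) by field.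
have -> : (u + u^*) / 2 = (complex.Re u)%:C.
  by rewrite (ReJ_add u).
have -> : 'i%C * (u - u^*) / 2 = - (complex.Im u)%:C.
  by rewrite (ImJ_sub u) -[conjc u]/(u^*); field.
rewrite /formal_differential -/a -/b; clearbody a b.
rewrite /mx_act !mxE /=; apply/eqP; rewrite eq_complex.
by case: a b => [a1 a2] [b1 b2] /=; apply/andP; split; apply/eqP; ring.
Qed.

Lemma op_norm_formal f z :
  op_norm (formal_differential f z) = normc (dz f z) + normc (dzbar f z).
Proof.
set p := dz f z; set q := dzbar f z.
have ub : ubound [set normc (mx_act (formal_differential f z) w)
    | w in [set w | normc w = 1]] (normc p + normc q).
  move=> _ [w /= w1 <-]; rewrite formal_differentialE.
  by apply: le_trans (le_normcD _ _) _; rewrite !normcM normc_conj w1 !mulr1.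
have n1 : [set w : R[i] | normc w = 1] 1 by exact: normc1.
apply/eqP; rewrite eq_le; apply/andP; split.
  rewrite /op_norm; apply: ge_sup => //.
  by exists (normc (mx_act (formal_differential f z) 1)), 1.
have [d d1 dE] := align p q; rewrite -dE.
pose s := (sqrtC d)^*.
have s1 : normc s = 1.
  rewrite normc_conj; apply/eqP; rewrite -(@pexpr_eq1 _ _ 2)// ?normc_ge0//.
  by rewrite -normcX sqrtCK d1.
apply: ub_le_sup; first by exists (normc p + normc q).
exists s => //; rewrite formal_differentialE -/p -/q.
have -> : p * s + q * s^* = s * (p + d * q).
  rewrite -[in d * q](sqrtCK d) mulrDr [s * p]mulrC; congr (_ + _).
  have -> : s * (sqrtC d ^+ 2 * q) = (sqrtC d * (sqrtC d)^*) * sqrtC d * q.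
    by rewrite /s; ring.
  by rewrite mulcJ -[normc _]normc_conj s1 expr1n mul1r /s conjK mulrC.
by rewrite normcM s1 mul1r.
Qed.

(* A null set contains no square, since squares have positive area. *)
Lemma ae_disk_dense (P : R[i] -> Prop) z (e : R) : ae_disk P -> unit_disk z -> 0 < e ->
  exists2 w, normc (w - z) < e & unit_disk w /\ P w.
Proof.
move=> [A [mA A0 subA]] zd e0; apply: contrapT => H.
have zd' : normc z < 1 by [].
(* Points of the square of half-side d are within 2 d of z, which is less than e and less than the
   distance to the unit circle. *)
pose d := Num.min e (1 - normc z) / 4.
have d0 : 0 < d by rewrite divr_gt0// lt_min e0 subr_gt0.
have de : 2 * d < e.
  have : Num.min e (1 - normc z) <= e by rewrite ge_min lexx.
  by rewrite /d; lra.
have dz1 : 2 * d < 1 - normc z.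
  have : Num.min e (1 - normc z) <= 1 - normc z by rewrite ge_min lexx orbT.
  by rewrite /d; lra.
pose I (x : R) : set R := `[x - d, x + d]%classic.
have mI x : measurable (I x : set (measurableTypeR R)) by exact: measurable_itv.
have muI x : lebesgue_measure (I x) = (2 * d)%:E :> \bar R.
  rewrite lebesgue_measure_itv/= lte_fin ifT; last by lra.
  by rewrite -EFinB; congr EFin; ring.
have : (area R (I (complex.Re z) `*` I (complex.Im z)) <= area R A)%E.
  apply: le_measure; rewrite ?inE//; first exact: measurableX.
  move=> [x y] [/= ]; rewrite /I /= !in_itv /= => /andP[x1 x2] /andP[y1 y2].
  apply: subA => Pxy; apply: H.
  have wz : normc (cplx (x, y) - z) <= 2 * d.
    apply: le_trans (normc_le_ReIm _) _; rewrite ReB ImB /=.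
    rewrite (_ : 2 * d = d + d); last by ring.
    by rewrite lerD// ler_norml; apply/andP; split; lra.
  have wd : unit_disk (cplx (x, y)).
    rewrite /unit_disk/= -[cplx _](subrK z); apply: le_lt_trans (le_normcD _ _) _.
    by lra.
  exists (cplx (x, y)); first exact: le_lt_trans de.
  by split => //; exact: Pxy.
have -> : area R (I (complex.Re z) `*` I (complex.Im z)) = (2 * d * (2 * d))%:E.
  rewrite product_measure1E// EFinM; exact: (congr2 mule (muI _) (muI _)).
by rewrite A0 lee_fin leNgt mulr_gt0//; lra.
Qed.

Section Bound.
Variables (K K' lambda : R).
Hypotheses (K1 : 1 <= K) (K'0 : 0 <= K') (lam1 : 1 <= lambda).

Definition dilation_bound := (K * lambda + Num.sqrt (K ^+ 2 * lambda ^+ 2 + 4 * K')) / 2.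
Local Notation M := dilation_bound.

Let S_ge : K * lambda <= Num.sqrt (K ^+ 2 * lambda ^+ 2 + 4 * K').
Proof.
have Kl : 0 <= K * lambda by rewrite mulr_ge0//; move: K1 lam1; lra.
rewrite -{1}(ger0_norm Kl) -sqrtr_sqr exprMn ler_wsqrtr//.
by rewrite lerDl mulr_ge0.
Qed.

Lemma dilation_bound_ge : K * lambda <= M.
Proof. by rewrite /M; move: S_ge; lra. Qed.

Lemma dilation_bound_gt0 : 0 < M.
Proof. by apply: lt_le_trans dilation_bound_ge; rewrite mulr_gt0//; move: K1 lam1; lra. Qed.

Lemma dilation_bound_sqr : M ^+ 2 = K * lambda * M + K'.
Proof.
have SS : Num.sqrt (K ^+ 2 * lambda ^+ 2 + 4 * K') ^+ 2 = K ^+ 2 * lambda ^+ 2 + 4 * K'.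
  rewrite sqr_sqrtr// -exprMn; apply: addr_ge0; first exact: sqr_ge0.
  by apply: mulr_ge0.
rewrite /M; move: SS; set S := Num.sqrt _ => SS.
have -> : ((K * lambda + S) / 2) ^+ 2 = (K ^+ 2 * lambda ^+ 2 + 2 * K * lambda * S + S ^+ 2) / 4 by field.
by rewrite SS; field.
Qed.

(** The denominator in [coef_bound] is 2 M, so the bracket is (K lambda M + K' - 1) / M = (M^2 - 1)
    / M. *)
Lemma coef_boundE n : coef_bound K K' lambda n = n%:R^-1 * (M - 1 / M).
Proof.
have M0 := dilation_bound_gt0; have M2 := dilation_bound_sqr.
rewrite /coef_bound; congr (_ * _).
have -> : K * lambda + Num.sqrt (K ^+ 2 * lambda ^+ 2 + 4 * K') = 2 * M.
  by rewrite /M; field.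
have M0' : M != 0 by rewrite gt_eqF.
move: M M0' M2 => m m0 m2; apply: (mulfI m0).
transitivity (K * lambda * m + K' - 1); first by field.
by rewrite -m2; field.
Qed.

(** With s = x + y, factoring x^2 - y^2 gives s^2 <= K lambda s + K', that is (s - M) (s + M - K
    lambda) <= 0. The second root K lambda - M is not positive, so s > M is impossible. *)
Lemma le_dilation_bound (x y : R) : 0 <= x -> 0 <= y -> `|x - y| <= lambda ->
  (x + y) ^+ 2 <= K * (x ^+ 2 - y ^+ 2) + K' -> x + y <= M.
Proof.
move=> x0 y0; rewrite ler_norml => /andP[_ xy] h; rewrite leNgt; apply/negP => Mxy.
have M0 := dilation_bound_gt0; have M2 := dilation_bound_sqr.
have MK := dilation_bound_ge.
have h1 : K * (x ^+ 2 - y ^+ 2) <= K * lambda * (x + y).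
  rewrite subr_sqr -mulrA ler_wpM2l//; first by move: K1; lra.
  by rewrite ler_wpM2r// addr_ge0.
have h2 : (x + y - M) * (x + y + M - K * lambda) <= 0.
  have -> : (x + y - M) * (x + y + M - K * lambda) =
    (x + y) ^+ 2 - M ^+ 2 + K * lambda * M - K * lambda * (x + y) by ring.
  by rewrite M2; lra.
by move: h2; rewrite leNgt => /negP; apply; rewrite mulr_gt0//; lra.
Qed.

End Bound.

Lemma elliptic_harmonic_coef_bound (K K' lambda : R) f h g (a b : nat -> R[i]) :
  1 <= K -> 0 <= K' ->
  ae_disk (fun z => op_norm (formal_differential f z) ^+ 2 <= K * jac f z + K') ->
  (forall z, unit_disk z -> f z = h z + (g z)^*) ->
  taylor_on_disk h a -> taylor_on_disk g b ->
  min_dilation f 0 = 1 -> (forall z, unit_disk z -> min_dilation f z <= lambda) ->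
  forall n : nat, (2 <= n)%N -> normc (a n) + normc (b n) <= coef_bound K K' lambda n.
Proof.
move=> K1 K'0 qc fhg ha gb f0 flam n n2.
have lam1 : 1 <= lambda by rewrite -f0 flam//; exact: unit_disk0.
have [h' ha'] := radius_taylor (radius_diff (taylor_radius ha)).
have [g' gb'] := radius_taylor (radius_diff (taylor_radius gb)).
have fz z : unit_disk z -> rdiff f z (h' z) (g' z)^*.
  move=> zd; apply: (@rdiff_eq _ (fun w => h w + (g w)^*)) => //.
    by move=> w /fhg.
  rewrite -[h' z]addr0 -[(g' z)^*]add0r -{1}conjC0.
  by apply: rdiffD (taylor_rdiff ha ha' zd) (rdiffJ (taylor_rdiff gb gb' zd)).
set M := dilation_bound K K' lambda.
have M0 : 0 < M by exact: dilation_bound_gt0.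
have hgM z : unit_disk z -> normc (h' z) + normc (g' z) <= M.
  move=> zd; apply/ler_addgt0Pr => e e0; have e2 : 0 < e / 2 by rewrite divr_gt0.
  have [d d0 Hd] := (continuousC _ _).1 (taylor_continuous ha' zd) _ e2.
  have [d' d0' Hd'] := (continuousC _ _).1 (taylor_continuous gb' zd) _ e2.
  have dd : 0 < Num.min d d' by rewrite lt_min d0.
  have [w] := ae_disk_dense qc zd dd.
  rewrite lt_min => /andP[/Hd w1 /Hd' w2] [wd].
  rewrite op_norm_formal /jac (rdiff_dz (fz _ wd)) (rdiff_dzbar (fz _ wd)) normc_conj => hw.
  have := flam _ wd; rewrite /min_dilation (rdiff_dz (fz _ wd)) (rdiff_dzbar (fz _ wd)) normc_conj.
  move=> /(le_dilation_bound K1 K'0 lam1 (normc_ge0 _) (normc_ge0 _))/(_ hw).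
  have := ler_normc_sub (h' z) (h' w); have := ler_normc_sub (g' z) (g' w).
  rewrite [normc (g' z - _)]normcB [normc (h' z - _)]normcB -/M.
  lra.
(* The index is now n.+1 with n > 0. Differentiation lowers it by one, so indices from 2 on
   correspond to the non-constant coefficients of h' + d g'. *)
case: n n2 => // n n1; rewrite coef_boundE//.
have [d d1 dE] := align (a n.+1) (b n.+1).
have FM z : unit_disk z -> normc (h' z + d * g' z) <= M.
  move=> zd; apply: le_trans (le_normcD _ _) _; rewrite normcM d1 mul1r.
  exact: hgM.
have := schwarz_pick_coef (taylorD ha' (taylorZ (c := d) gb')) M0 FM n1.
have -> : diff_coef a n + d * diff_coef b n = n.+1%:R * (a n.+1 + d * b n.+1).
  by rewrite /diff_coef; ring.
rewrite normcM normc_nat dE => hn.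
rewrite mulrC ler_pdivlMr ?ltr0n// mulrC; apply: le_trans hn _.
rewrite lerD2l lerN2 ler_wpM2r ?invr_ge0 ?(ltW M0)//.
rewrite -(expr1n R 2) lerXn2r// ?nnegrE ?normc_ge0//.
move: f0; rewrite /min_dilation.
rewrite (rdiff_dz (fz _ (unit_disk0 R))) (rdiff_dzbar (fz _ (unit_disk0 R))) normc_conj => <-.
rewrite (taylor0 ha') (taylor0 gb').
have -> : normc (diff_coef b 0) = normc (- (d * diff_coef b 0)).
  by rewrite normcN [RHS]normcM d1 mul1r.
by apply: le_trans (ler_dist_normc _ _) _; rewrite opprK.
Qed.

End EllipticBound.

(** * Winding numbers *)

Section Winding.
Variable R : realType.
Implicit Types (gamma eta : R -> R[i]) (t s r : R) (z w c zeta : R[i]).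

Definition continuous_path gamma :=
  continuous (fun t => complex.Re (gamma t)) /\ continuous (fun t => complex.Im (gamma t)).

Lemma continuous_path_cst c : continuous_path (fun=> c).
Proof. by split=> t; exact: cvg_cst. Qed.

Lemma continuous_path_cis : continuous_path (@cis R).
Proof. by split=> t; [exact: continuous_cos|exact: continuous_sin]. Qed.

Lemma continuous_pathP gamma : continuous_path gamma <->
  forall t e, 0 < e -> exists2 d : R, 0 < d &
    forall s, `|s - t| < d -> normc (gamma s - gamma t) < e.
Proof.
split=> [[g1 g2] t e e0|H].
  have e2 : 0 < e / 2 by rewrite divr_gt0.
  have /cvgrPdist_lt/(_ _ e2)/nbhs_normP[/= d d0 Hd] := g1 t.
  have /cvgrPdist_lt/(_ _ e2)/nbhs_normP[/= d' d0' Hd'] := g2 t.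
  exists (Num.min d d'); first by rewrite lt_min d0.
  move=> s; rewrite lt_min distrC => /andP[/Hd h1 /Hd' h2].
  apply: le_lt_trans (normc_le_ReIm _) _.
  by rewrite ReB ImB [e]splitr distrC [X in _ + X]distrC ltrD.
split=> t; apply/cvgrPdist_lt => e e0; have [d d0 Hd] := H t e e0;
  apply/nbhs_normP; exists d => //= s /=; rewrite distrC => /Hd h;
  rewrite distrC; apply: le_lt_trans h.
- by rewrite -ReB Re_le_normc.
- by rewrite -ImB Im_le_normc.
Qed.

Lemma continuous_pathD gamma eta : continuous_path gamma -> continuous_path eta ->
  continuous_path (fun t => gamma t + eta t).
Proof.
move=> [g1 g2] [e1 e2]; split.
- have -> : (fun t => complex.Re (gamma t + eta t)) =
      (fun t => complex.Re (gamma t) + complex.Re (eta t)).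
    by apply/funext => t; case: (gamma t) (eta t) => [? ?] [? ?].
  by move=> t; apply: cvgD; [exact: g1|exact: e1].
- have -> : (fun t => complex.Im (gamma t + eta t)) =
      (fun t => complex.Im (gamma t) + complex.Im (eta t)).
    by apply/funext => t; case: (gamma t) (eta t) => [? ?] [? ?].
  by move=> t; apply: cvgD; [exact: g2|exact: e2].
Qed.

Lemma continuous_pathM gamma eta : continuous_path gamma -> continuous_path eta ->
  continuous_path (fun t => gamma t * eta t).
Proof.
move=> [g1 g2] [e1 e2]; split.
- have -> : (fun t => complex.Re (gamma t * eta t)) =
      (fun t => complex.Re (gamma t) * complex.Re (eta t) - complex.Im (gamma t) * complex.Im (eta t)).
    by apply/funext => t; case: (gamma t) (eta t) => [? ?] [? ?].
  by move=> t; apply: cvgB; apply: cvgM; [exact: g1|exact: e1|exact: g2|exact: e2].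
- have -> : (fun t => complex.Im (gamma t * eta t)) =
      (fun t => complex.Re (gamma t) * complex.Im (eta t) + complex.Im (gamma t) * complex.Re (eta t)).
    by apply/funext => t; case: (gamma t) (eta t) => [? ?] [? ?].
  by move=> t; apply: cvgD; apply: cvgM; [exact: g1|exact: e2|exact: g2|exact: e1].
Qed.

Lemma continuous_pathV gamma : continuous_path gamma -> (forall t, gamma t != 0) ->
  continuous_path (fun t => (gamma t)^-1).
Proof.
move=> [g1 g2] g0.
have nc : continuous (fun t => (complex.Re (gamma t) ^+ 2 + complex.Im (gamma t) ^+ 2)^-1).
  move=> t; apply: cvgV; first by rewrite -sqr_normcE expf_neq0// normc_eq0.
  by apply: cvgD; rewrite !expr2; apply: cvgM; (exact: g1 || exact: g2).
split.
- have -> : (fun t => complex.Re (gamma t)^-1) = (fun t =>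
      complex.Re (gamma t) * (complex.Re (gamma t) ^+ 2 + complex.Im (gamma t) ^+ 2)^-1).
    by apply/funext => t; case: (gamma t).
  by move=> t; apply: cvgM; [exact: g1|exact: nc].
- have -> : (fun t => complex.Im (gamma t)^-1) = (fun t =>
      - (complex.Im (gamma t) * (complex.Re (gamma t) ^+ 2 + complex.Im (gamma t) ^+ 2)^-1)).
    by apply/funext => t; case: (gamma t).
  by move=> t; apply: cvgN; apply: cvgM; [exact: g2|exact: nc].
Qed.

Lemma continuous_path_normc gamma : continuous_path gamma ->
  continuous (fun t => normc (gamma t)).
Proof.
move=> /continuous_pathP gc t; apply/cvgrPdist_lt => e e0.
have [d d0 Hd] := gc t e e0; apply/nbhs_normP; exists d => //= s /=.
by rewrite distrC => /Hd; rewrite normcB; apply: le_lt_trans; exact: ler_dist_normc.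
Qed.

(** [acos] reaches the upper half circle only; the lower one uses 2 pi - acos. *)
Lemma circle_cis z : normc z = 1 -> exists2 t, 0 <= t <= 2 * pi & z = cis t.
Proof.
move=> z1; have := sqr_normcE z; rewrite z1 expr1n.
case: z {z1} => a b /= ab.
have a1 : -1 <= a <= 1.
  by rewrite -ler_norml -(@expr_le1 _ 2)// real_normK ?num_real//; nra.
have ca : cos (acos a) = a by rewrite acosK// in_itv.
have sa : sin (acos a) = `|b|.
  rewrite sin_acos// (_ : 1 - a ^+ 2 = b ^+ 2) ?sqrtr_sqr//.
  by rewrite ab; ring.
have a0 := acos_ge0 a1; have api := acos_lepi a1.
have p0 := pi_gt0 R.
have [b0|b0] := leP 0 b.
  exists (acos a); first by apply/andP; split; lra.
  by rewrite /cis ca sa ger0_norm.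
exists (2 * pi - acos a); first by apply/andP; split; lra.
rewrite /cis addrC mulr_natl cosD2pi sinD2pi cosN sinN ca sa ltr0_norm//.
by rewrite opprK.
Qed.

Lemma polar c : c != 0 -> exists t, c = (normc c)%:C * cis t.
Proof.
move=> c0; have nc : normc c != 0 by rewrite normc_eq0.
have nc' : (normc c)%:C != 0 :> R[i].
  by rewrite -(rmorph0 (real_complex R)) (inj_eq (@complexI R)).
have [|t _ tE] := @circle_cis (c / (normc c)%:C).
  by rewrite normc_div normcR ger0_norm ?normc_ge0// divff.
by exists t; rewrite -tE mulrC divfK.
Qed.

Lemma polar_right z : 0 < complex.Re z ->
  z = (normc z)%:C * cis (atan (complex.Im z / complex.Re z)).
Proof.
case: z => a b /= a0; set x := b / a.
have x1 : 0 < 1 + x ^+ 2 by rewrite ltr_wpDr// sqr_ge0.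
have sx : Num.sqrt (1 + x ^+ 2) != 0 by rewrite gt_eqF// sqrtr_gt0.
have cx : cos (atan x) != 0 by rewrite cos_atan invr_eq0.
have sinx : sin (atan x) = x * cos (atan x).
  by have [_ tx] := atan_def x; rewrite -{2}tx /tan divfK.
have nz : normc (a +i* b) = a * Num.sqrt (1 + x ^+ 2).
  rewrite /normc -{2}(ger0_norm (ltW a0)) -sqrtr_sqr -sqrtrM ?sqr_ge0//.
  by congr Num.sqrt; rewrite /x; field; rewrite gt_eqF.
rewrite /cis sinx cos_atan nz; apply/eqP; rewrite eq_complex /=.
have a0' : a != 0 by rewrite gt_eqF.
by apply/andP; split; apply/eqP; rewrite /x; field; rewrite ?a0' sx.
Qed.

Lemma winds_eq gamma eta k : gamma =1 eta -> winds gamma k -> winds eta k.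
Proof. by move=> /funext ->. Qed.

Lemma windsM gamma eta k l : winds gamma k -> winds eta l ->
  winds (fun t => gamma t * eta t) (k + l).
Proof.
move=> [th [thc Hth thE]] [ph [phc Hph phE]].
exists (fun t => th t + ph t); split.
- by move=> t; apply: cvgD; [exact: thc|exact: phc].
- move=> t tI; have [n1 E1] := Hth t tI; have [n2 E2] := Hph t tI.
  split; first by rewrite normcM mulf_neq0.
  by rewrite {1}E1 {1}E2 normcM cisD rmorphM /=; ring.
- by rewrite opprD addrACA thE phE intrD (mulrDr (2 * pi)).
Qed.

Lemma winds_cst c : c != 0 -> winds (fun=> c) 0.
Proof.
move=> c0; have [t cE] := polar c0; exists (fun=> t); split.
- by move=> s; exact: cvg_cst.
- by move=> s _; rewrite normc_eq0.
- by rewrite subrr mulr0.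
Qed.

Lemma cis2pi : cis (2 * pi : R) = cis 0.
Proof. by rewrite /cis mulr_natl cos2pi sin2pi cos0 sin0. Qed.

Lemma winds_cis : winds (@cis R) 1.
Proof.
exists id; split.
- by move=> t; apply: continuous_subspaceT => s; exact: cvg_id.
- by move=> t _; rewrite normc_cis oner_eq0 mul1r.
- by rewrite subr0 mulr1.
Qed.

(** The disk of radius 1 about 1 lies in the right half-plane, where atan (Im / Re) is a
    single-valued continuous argument; a closed path brings it back to its initial value. *)
Lemma winds_near1 gamma : continuous_path gamma -> gamma (2 * pi) = gamma 0 ->
  (forall t, normc (gamma t - 1) < 1) -> winds gamma 0.
Proof.
move=> [g1 g2] gp gn.
have re0 t : 0 < complex.Re (gamma t).
  have := le_lt_trans (Re_le_normc _) (gn t); rewrite ReB /= ltr_norml.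
  by move=> /andP[]; lra.
exists (fun t => atan (complex.Im (gamma t) / complex.Re (gamma t))); split.
- apply: continuous_subspaceT => t.
  have h : (complex.Im (gamma s) / complex.Re (gamma s)) @[s --> t] -->
      complex.Im (gamma t) / complex.Re (gamma t).
    by apply: cvgM; [exact: g2|apply: cvgV; [rewrite gt_eqF|exact: g1]].
  by apply: (cvg_comp _ _ h); exact: continuous_atan.
- move=> t _; split; last exact: polar_right.
  by rewrite normc_eq0; apply: contraTneq (re0 t) => ->; rewrite ltxx.
- by rewrite gp subrr mulr0.
Qed.

(** Factor out the dominant term, r cis t if zeta is inside the circle and c - zeta if it is
    outside. What remains is within distance 1 of 1 and does not wind. *)
Lemma winds_root c r zeta : 0 < r -> normc (zeta - c) != r ->
  winds (fun t => c + r%:C * cis t - zeta) (nat_of_bool (normc (zeta - c) < r)%R)%:R.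
Proof.
move=> r0 zr; have r0' : r%:C != 0 :> R[i] by rewrite -normc_eq0 normcR normr_eq0 gt_eqF.
have nr : normc (r%:C : R[i]) = r by rewrite normcR gtr0_norm.
have [zin|zout] := boolP (normc (zeta - c) < r).
  have cis0' t : cis t != 0 :> R[i] by rewrite -normc_eq0 normc_cis oner_eq0.
  apply: (@winds_eq (fun t => r%:C * cis t * (1 - (zeta - c) / r%:C * (cis t)^-1))).
    by move=> t; field; rewrite r0' cis0'.
  rewrite -[1%:R : int](addr0 1); apply: windsM.
    rewrite -[1](add0r (1:int)); apply: windsM winds_cis; exact: winds_cst.
  apply: winds_near1.
  - apply: continuous_pathD; first exact: continuous_path_cst.
    have -> : (fun t => - ((zeta - c) / r%:C * (cis t)^-1)) =
      (fun t => - ((zeta - c) / r%:C) * (cis t)^-1) by apply/funext => t; rewrite mulNr.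
    apply: continuous_pathM; first exact: continuous_path_cst.
    exact: (continuous_pathV continuous_path_cis).
  - by rewrite cis2pi.
  - move=> t; rewrite addrAC subrr add0r normcN normcM normc_div normcV normc_cis nr.
    by rewrite invr1 mulr1 ltr_pdivrMr// mul1r.
have zgt : r < normc (c - zeta) by rewrite normcB lt_def zr leNgt.
have cz : c - zeta != 0 by rewrite -normc_eq0 gt_eqF// (lt_trans r0).
apply: (@winds_eq (fun t => (c - zeta) * (1 + r%:C / (c - zeta) * cis t))).
  by move=> t; field.
rewrite -[0%:R : int](addr0 0); apply: windsM; first exact: winds_cst.
apply: winds_near1.
- apply: continuous_pathD; first exact: continuous_path_cst.
  by apply: continuous_pathM continuous_path_cis; exact: continuous_path_cst.
- by rewrite cis2pi.
- move=> t; rewrite addrAC subrr add0r normcM normc_div normc_cis nr mulr1.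
  by rewrite ltr_pdivrMr ?mul1r// (lt_trans r0).
Qed.

Lemma winds_prod_roots c r (rs : seq R[i]) : 0 < r ->
  (forall zeta, zeta \in rs -> normc (zeta - c) != r) ->
  winds (fun t => \prod_(zeta <- rs) (c + r%:C * cis t - zeta))
    (count (fun zeta => normc (zeta - c) < r)%R rs)%:R.
Proof.
move=> r0; elim: rs => [|zeta rs IH] H.
  apply: (@winds_eq (fun=> 1)); first by move=> t; rewrite big_nil.
  by apply: winds_cst; exact: oner_neq0.
rewrite /= natrD; apply: winds_eq (windsM (winds_root r0 (H zeta (mem_head _ _))) (IH _)).
  by move=> t; rewrite big_cons.
by move=> z zrs; apply: H; rewrite inE zrs orbT.
Qed.

(** After splitting p into linear factors, the winding number counts the roots inside the circle
    with multiplicity; it is positive because z1 is one of them. *)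
Lemma winds_poly (p : {poly R[i]}) c r z1 : 0 < r -> normc (z1 - c) < r ->
  root p z1 -> (forall t, p.[c + r%:C * cis t] != 0) ->
  exists2 k : int, 0 < k & winds (fun t => p.[c + r%:C * cis t]) k.
Proof.
move=> r0 z1r pz1 pc; have [rs pE] := closed_field_poly_normal p.
have lp : lead_coef p != 0.
  by apply: contraTneq (pc 0) => l0; rewrite pE l0 scale0r horner0 eqxx.
have pzE z : p.[z] = lead_coef p * \prod_(zeta <- rs) (z - zeta).
  rewrite {1}pE hornerZ horner_prod; congr (_ * _).
  by apply: eq_bigr => zeta _; rewrite !hornerE.
have rootE z : root p z = (z \in rs).
  by rewrite pE rootZ// root_prod_XsubC.
have rsc zeta : zeta \in rs -> normc (zeta - c) != r.
  move=> zrs; apply/eqP => zr; have rC : r%:C != 0 :> R[i].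
    by rewrite -normc_eq0 normcR normr_eq0 gt_eqF.
  have [|t _ tE] := @circle_cis ((zeta - c) / r%:C).
    by rewrite normc_div normcR zr gtr0_norm// divff// gt_eqF.
  have := pc t; rewrite -tE [r%:C * _]mulrC divfK// addrC subrK.
  by rewrite -/(root p zeta) rootE zrs.
exists (count (fun zeta => normc (zeta - c) < r)%R rs)%:R.
  by rewrite ltr0n -has_count; apply/hasP; exists z1; rewrite -?rootE.
apply: (@winds_eq (fun t => lead_coef p * \prod_(zeta <- rs) (c + r%:C * cis t - zeta))).
  by move=> t; rewrite pzE.
by rewrite -[_%:R]add0r; apply: windsM (winds_cst lp) (winds_prod_roots r0 rsc).
Qed.


End Winding.

(** * Analytic maps are sense-preserving *)

Section SensePreserving.
Variable R : realType.
Implicit Types (F : R[i] -> R[i]) (a : nat -> R[i]).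

(** The point of the closed disk farthest from 0, in the direction of c, has modulus |c| + r. *)
Lemma closed_disk_radius (c : R[i]) (r : R) : 0 < r ->
  (forall z, normc (z - c) <= r -> unit_disk z) -> normc c + r < 1.
Proof.
move=> r0 H; have [d d1] := align c r%:C.
have rE : normc (r%:C : R[i]) = r by rewrite normcR gtr0_norm.
rewrite rE => <-; apply: H.
by rewrite addrAC subrr add0r normcM d1 mul1r rE.
Qed.

Lemma horner_psum a N z : (\poly_(i < N) a i).[z] = psum a z N.
Proof. by rewrite horner_poly. Qed.

Lemma continuous_path_psum (gamma : R -> R[i]) a N :
  continuous_path gamma -> continuous_path (fun t => psum a (gamma t) N).
Proof.
move=> gc; rewrite /psum; elim: N => [|N IH].
  by under eq_fun do rewrite big_ord0; exact: continuous_path_cst.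
under eq_fun do rewrite big_ord_recr /=.
apply: continuous_pathD IH _; apply: continuous_pathM; first exact: continuous_path_cst.
elim: N => [|N IH]; first exact: continuous_path_cst.
under eq_fun do rewrite exprS.
exact: continuous_pathM.
Qed.

(* Rouche: on the boundary circle [F - F z1] is a small relative perturbation of
   the same difference for a Taylor polynomial, whose winding number counts roots. *)
Lemma taylor_sense_preserving F a : taylor_on_disk F a -> sense_preserving F.
Proof.
(* The closed disk of radius rho about 0 contains the given one, and rho < 1 makes the uniform
   Taylor estimates available. *)
move=> Fa c r r0 cr z1 z1r F1; pose rho := normc c + r.
have rho01 : 0 < rho < 1.
  by rewrite closed_disk_radius// ltr_wpDl ?normc_ge0.
have gn t : normc (c + r%:C * cis t) <= rho.
  apply: le_trans (le_normcD _ _) _.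
  by rewrite normcM normcR normc_cis mulr1 gtr0_norm.
have z1rho : normc z1 <= rho.
  rewrite -[z1](subrK c) addrC; apply: le_trans (le_normcD _ _) _.
  by rewrite lerD2l ltW.
have gC : continuous_path (fun t => c + r%:C * cis t).
  apply: continuous_pathD; first exact: continuous_path_cst.
  by apply: continuous_pathM (@continuous_path_cis R); exact: continuous_path_cst.
pose G t := F (c + r%:C * cis t) - F z1.
have GC : continuous_path G.
  apply/continuous_pathP => t e e0; have [L L0 HL] := taylor_lipschitz Fa rho01.
  have L1 : 0 < L + 1 by rewrite ltr_wpDl.
  have [d d0 Hd] := (continuous_pathP _).1 gC t _ (divr_gt0 e0 L1).
  exists d => // s /Hd; rewrite ltr_pdivlMr// => h.
  have -> : G s - G t = F (c + r%:C * cis s) - F (c + r%:C * cis t) by rewrite /G; ring.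
  apply: le_lt_trans (HL _ _ (gn t) (gn s)) _; apply: le_lt_trans h.
  by rewrite mulrC ler_wpM2l ?normc_ge0// lerDl.
have G0 t : G t != 0.
  rewrite subr_eq0; apply: F1.
  by rewrite addrAC subrr add0r normcM normcR normc_cis mulr1 gtr0_norm.
have [t0 _ t0min] : exists2 t0, t0 \in `[0, 2 * pi] &
    forall t, t \in `[0, 2 * pi] -> normc (G t0) <= normc (G t).
  apply: EVT_min; first by rewrite mulr_ge0 ?pi_ge0.
  by apply: continuous_subspaceT; exact: continuous_path_normc.
set m := normc (G t0) in t0min.
have m0 : 0 < m by rewrite normc_gt0.
have mG t : m <= normc (G t).
  have [s s01 sE] := circle_cis (normc_cis t).
  by rewrite /G sE; apply: t0min; rewrite in_itv.
(* Two tail errors, on the circle and at z1, give |G - p| <= 2 m / 5; hence |p| >= 3 m / 5 and |G /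
   p - 1| < 1. *)
have m5 : 0 < m / 5 by rewrite divr_gt0.
have [N HN] := taylor_tail Fa rho01 m5.
(* Subtracting the partial sum at z1 rather than F z1 makes z1 an exact root. *)
pose p := \poly_(i < N) a i - (psum a z1 N)%:P.
have pE z : p.[z] = psum a z N - psum a z1 N.
  by rewrite hornerD hornerN hornerC horner_psum.
have Gp t : normc (G t - p.[c + r%:C * cis t]) <= 2 * (m / 5).
  rewrite pE (_ : _ - _ = (F (c + r%:C * cis t) - psum a (c + r%:C * cis t) N)
      - (F z1 - psum a z1 N)); last by rewrite /G; ring.
  by apply: le_trans (le_normcB _ _) _; rewrite mulr_natl lerD// HN.
have pm t : 3 * (m / 5) <= normc p.[c + r%:C * cis t].
  have := ler_normc_sub (G t) p.[c + r%:C * cis t]; have := Gp t; have := mG t; lra.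
have p0 t : p.[c + r%:C * cis t] != 0.
  by rewrite -normc_gt0; apply: lt_le_trans (pm t); lra.
have [|k k0 pk] := winds_poly r0 z1r _ p0; first by rewrite /root pE subrr.
exists k => //; rewrite -[k]addr0.
apply: (@winds_eq _ (fun t => p.[c + r%:C * cis t] * (G t / p.[c + r%:C * cis t]))).
  by move=> t; rewrite mulrC divfK.
apply: windsM pk _; apply: winds_near1.
- apply: continuous_pathM GC _; apply: continuous_pathV p0.
  have -> : (fun t => p.[c + r%:C * cis t]) =
      (fun t => psum a (c + r%:C * cis t) N + - psum a z1 N).
    by apply/funext => t; rewrite pE.
  apply: continuous_pathD (continuous_path_cst _).
  exact: continuous_path_psum.
- by rewrite /G cis2pi.
- move=> t; have pt : 0 < normc p.[c + r%:C * cis t] by rewrite normc_gt0.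
  have -> : G t / p.[c + r%:C * cis t] - 1 =
      (G t - p.[c + r%:C * cis t]) / p.[c + r%:C * cis t].
    by rewrite [RHS]mulrBl divff.
  rewrite normc_div ltr_pdivrMr// mul1r; have := Gp t; have := pm t; lra.
Qed.

End SensePreserving.

(** * Analytic maps as elliptic harmonic maps *)

Section AnalyticMaps.
Variable R : realType.
Implicit Types (F G H k : R[i] -> R[i]) (a : nat -> R[i]).

Lemma unit_disk_near (z : R[i]) : unit_disk z ->
  exists2 d : R, 0 < d & forall w, normc (w - z) < d -> unit_disk w.
Proof.
move=> zd; exists (1 - normc z); first by rewrite subr_gt0.
move=> w wz; rewrite /unit_disk/= -[w](subrK z).
by apply: le_lt_trans (le_normcD _ _) _; rewrite -ltrBrDr.
Qed.

Lemma continuous_on_disk_eq G H : (forall z, unit_disk z -> G z = H z) ->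
  continuous_on_disk H -> continuous_on_disk G.
Proof.
move=> GH Hc z zd; apply/continuousC => e e0.
have [d d0 Hd] := (continuousC _ _).1 (Hc z zd) e e0.
have [d' d0' Hd'] := unit_disk_near zd.
exists (Num.min d d'); first by rewrite lt_min d0.
by move=> w; rewrite lt_min => /andP[/Hd h1 /Hd' wd]; rewrite !GH.
Qed.

Section Holomorphic.
Variables (G H k : R[i] -> R[i]) (a : nat -> R[i]).
Hypotheses (GH : forall z, unit_disk z -> G z = H z)
  (Ha : taylor_on_disk H a) (ka : taylor_on_disk k (diff_coef a)).

(** G and H agree on the disk only, so that G can later be [dx F], [dy F] or [dz F], which match
    power series nowhere else. *)
Lemma holo_rdiff z : unit_disk z -> rdiff G z (k z) 0.
Proof.
move=> zd; apply: (rdiff_eq zd) (taylor_rdiff Ha ka zd) => w wd.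
by rewrite GH.
Qed.

Lemma holo_dx z : unit_disk z -> dx G z = k z.
Proof. by move=> zd; rewrite (rdiff_dx (holo_rdiff zd)) addr0. Qed.

Lemma holo_dy z : unit_disk z -> dy G z = 'i%C * k z.
Proof. by move=> zd; rewrite (rdiff_dy (holo_rdiff zd)) subr0. Qed.

Lemma holo_dz z : unit_disk z -> dz G z = k z.
Proof. by move=> zd; rewrite (rdiff_dz (holo_rdiff zd)). Qed.

Lemma holo_dzbar z : unit_disk z -> dzbar G z = 0.
Proof. by move=> zd; rewrite (rdiff_dzbar (holo_rdiff zd)). Qed.

Lemma holo_C1 : C1_on_disk G.
Proof.
split.
  move=> z /holo_rdiff zr; split.
  - exact: (@ex_derive _ _ _ _ _ _ _ (rdiff_Re_x zr)).
  - exact: (@ex_derive _ _ _ _ _ _ _ (rdiff_Im_x zr)).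
  - exact: (@ex_derive _ _ _ _ _ _ _ (rdiff_Re_y zr)).
  - exact: (@ex_derive _ _ _ _ _ _ _ (rdiff_Im_y zr)).
split; first exact: continuous_on_disk_eq holo_dx (taylor_continuous ka).
apply: continuous_on_disk_eq holo_dy (taylor_continuous (taylorZ (c := 'i%C) ka)).
Qed.

End Holomorphic.

Lemma taylor_harmonic F a : taylor_on_disk F a -> harmonic_map F.
Proof.
move=> Fa; have [k ka] := radius_taylor (radius_diff (taylor_radius Fa)).
have [k2 k2a] := radius_taylor (radius_diff (taylor_radius ka)).
have FF z : unit_disk z -> F z = F z by [].
split.
- exact: holo_C1 FF Fa ka.
- exact: holo_C1 (holo_dx FF Fa ka) ka k2a.
- have ika := taylorZ (c := 'i%C) ka.
  have [k3 k3a] := radius_taylor (radius_diff (taylor_radius ika)).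
  exact: holo_C1 (holo_dy FF Fa ka) ika k3a.
- by move=> z zd; rewrite (holo_dzbar (holo_dz FF Fa ka) ka k2a zd) mulr0.
Qed.

Lemma lipschitz_abs_continuous (x y L : R) (phi : R -> R[i]) : 0 <= L ->
  (forall s t, x <= s <= y -> x <= t <= y -> normc (phi t - phi s) <= L * `|t - s|) ->
  abs_continuous x y phi.
Proof.
move=> L0 HL e e0; have L1 : 0 < L + 1 by rewrite ltr_wpDl.
exists (e / (L + 1)); first by rewrite divr_gt0.
move=> s /allP sI _; rewrite ltr_pdivlMr// => se; apply: le_lt_trans se.
rewrite mulrC mulr_sumr big_seq [leRHS]big_seq; apply: ler_sum => I /sI /and3P[h1 h2 h3].
apply: le_trans (HL _ _ _ _) _; [by rewrite h1 (le_trans h2)|by rewrite h3 (le_trans h1)|].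
by rewrite ger0_norm ?subr_ge0// ler_wpM2r ?subr_ge0// lerDl.
Qed.

(** On a segment the modulus is at most its maximum at the endpoints, so the segment lies in a
    closed disk of radius less than 1, where F is Lipschitz. Absolute continuity thus holds on every
    line. *)
Lemma taylor_ACL F a : taylor_on_disk F a -> ACL F.
Proof.
move=> Fa x y x' y' xy xy' disk.
have key (s t : R) (gamma : R -> R[i]) : s < t ->
    unit_disk (gamma s) -> unit_disk (gamma t) ->
    (forall p, s <= p <= t -> normc (gamma p) <= Num.max (normc (gamma s)) (normc (gamma t))) ->
    (forall p q, normc (gamma q - gamma p) = `|q - p|) ->
    abs_continuous s t (fun p => F (gamma p)).
  move=> st gs gt gm gi.
  (* The term 1/2 only ensures a positive radius. *)
  pose rho := Num.max 2^-1 (Num.max (normc (gamma s)) (normc (gamma t))).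
  have rho01 : 0 < rho < 1.
    rewrite !lt_max !gt_max [_ < 1](_ : _ = true) //=; last by rewrite invf_lt1 ?ltr1n.
    by rewrite invr_gt0 ltr0n /=; apply/andP.
  have [L L0 HL] := taylor_lipschitz Fa rho01.
  have gr p : s <= p <= t -> normc (gamma p) <= rho.
    by move=> /gm h; rewrite le_max h orbT.
  apply: (lipschitz_abs_continuous L0) => p q ps qs.
  by rewrite -gi; apply: HL; exact: gr.
have sqr_le_max (s p t q : R) : s <= p <= t -> 
    Num.sqrt (p ^+ 2 + q ^+ 2) <= Num.max (Num.sqrt (s ^+ 2 + q ^+ 2)) (Num.sqrt (t ^+ 2 + q ^+ 2)).
  move=> /andP[sp pt]; rewrite le_max; have [p0|p0] := leP 0 p.
    by apply/orP; right; rewrite ler_wsqrtr// lerD2r; nra.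
  by apply/orP; left; rewrite ler_wsqrtr// lerD2r; nra.
split; apply: aeW => q qI.
- apply: key => //.
  + by apply: disk; rewrite // lexx ltW.
  + by apply: disk; rewrite // lexx ltW.
  + move=> p pI; exact: sqr_le_max.
  + by move=> p p'; rewrite -normcR; congr normc; apply/eqP; rewrite eq_complex /= subrr !eqxx.
- apply: key => //.
  + by apply: disk; rewrite // lexx ltW.
  + by apply: disk; rewrite // lexx ltW.
  + by move=> p pI; rewrite /normc ![q ^+ 2 + _]addrC; exact: sqr_le_max.
  + move=> p p'; rewrite -sqrtr_sqr /normc /=; congr Num.sqrt.
    by rewrite subrr expr0n add0r.
Qed.

End AnalyticMaps.

(** * Measurability, square integrability and null sets in the disk *)

Section SquareIntegrability.
Variable R : realType.
Local Notation plane := (measurableTypeR R * measurableTypeR R)%type.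

Definition measurableC (phi : plane -> R[i]) :=
  measurable_fun setT (fun p => complex.Re (phi p) : measurableTypeR R) /\
  measurable_fun setT (fun p => complex.Im (phi p) : measurableTypeR R).

Lemma measurableC_cst c : measurableC (fun=> c).
Proof. by split; exact: measurable_cst. Qed.

Lemma measurableC_cplx : measurableC (fun p => cplx p).
Proof. by split; [exact: measurable_fst|exact: measurable_snd]. Qed.

Lemma measurableCD phi psi : measurableC phi -> measurableC psi ->
  measurableC (fun p => phi p + psi p).
Proof.
move=> [f1 f2] [g1 g2]; split.
- apply: (eq_measurable_fun (fun p => complex.Re (phi p) + complex.Re (psi p))).
    by move=> p _; case: (phi p) (psi p) => [? ?] [? ?].
  exact: measurable_funD.
- apply: (eq_measurable_fun (fun p => complex.Im (phi p) + complex.Im (psi p))).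
    by move=> p _; case: (phi p) (psi p) => [? ?] [? ?].
  exact: measurable_funD.
Qed.

Lemma measurableCM phi psi : measurableC phi -> measurableC psi ->
  measurableC (fun p => phi p * psi p).
Proof.
move=> [f1 f2] [g1 g2]; split.
- apply: (eq_measurable_fun (fun p => complex.Re (phi p) * complex.Re (psi p) -
    complex.Im (phi p) * complex.Im (psi p))).
    by move=> p _; case: (phi p) (psi p) => [? ?] [? ?].
  by apply: measurable_funB; exact: measurable_funM.
- apply: (eq_measurable_fun (fun p => complex.Re (phi p) * complex.Im (psi p) +
    complex.Im (phi p) * complex.Re (psi p))).
    by move=> p _; case: (phi p) (psi p) => [? ?] [? ?].
  by apply: measurable_funD; exact: measurable_funM.
Qed.

Lemma measurableC_psum a N : measurableC (fun p => psum a (cplx p) N).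
Proof.
rewrite /psum; elim: N => [|N IH].
  by under eq_fun do rewrite big_ord0; exact: measurableC_cst.
under eq_fun do rewrite big_ord_recr /=.
apply: measurableCD IH _; apply: measurableCM; first exact: measurableC_cst.
elim: N => [|N IH]; first exact: measurableC_cst.
under eq_fun do rewrite exprS.
by apply: measurableCM IH; exact: measurableC_cplx.
Qed.

Definition plane_disk : set plane := [set p | unit_disk (cplx p)].

Lemma measurable_fun_sqr_normc (D : set plane) (phi : plane -> R[i]) :
  measurable_fun D (fun p => complex.Re (phi p) : measurableTypeR R) ->
  measurable_fun D (fun p => complex.Im (phi p) : measurableTypeR R) ->
  measurable_fun D (fun p => normc (phi p) ^+ 2 : measurableTypeR R).
Proof.
move=> mR mI.
apply: (eq_measurable_fun (fun p => complex.Re (phi p) ^+ 2 + complex.Im (phi p) ^+ 2)).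
  by move=> p _; rewrite sqr_normcE.
by apply: measurable_funD; apply: measurable_funX.
Qed.

Lemma measurable_plane_disk : measurable plane_disk.
Proof.
have [mR mI] := measurableC_cplx.
have m2 := measurable_fun_sqr_normc mR mI.
have -> : plane_disk = setT `&` (fun p : plane => normc (cplx p) ^+ 2) @^-1` `]-oo, (1:R)[%classic.
  rewrite setTI; apply/seteqP; split => p; rewrite /plane_disk /unit_disk /= in_itv /=.
    by move=> h; rewrite expr_lt1 ?normc_ge0.
  by rewrite expr_lt1 ?normc_ge0.
by apply: m2 => //; exact: measurable_itv.
Qed.

Lemma plane_disk_finite : (area R plane_disk < +oo)%E.
Proof.
pose I : set R := `[-1, 1]%classic.
have mI : measurable (I : set (measurableTypeR R)) by exact: measurable_itv.
have muI : lebesgue_measure I = 2%:E :> \bar R.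
  rewrite lebesgue_measure_itv/= lte_fin ifT; last by lra.
  by rewrite -EFinB; congr EFin; ring.
apply: (@le_lt_trans _ _ (area R (I `*` I))).
  apply: le_measure; rewrite ?inE; [exact: measurable_plane_disk|exact: measurableX|].
  move=> [x y]; rewrite /plane_disk /unit_disk /= => h.
  have := le_lt_trans (Re_le_normc _) h; have := le_lt_trans (Im_le_normc _) h.
  by rewrite /= !ltr_norml /I /= !in_itv /= => /andP[/ltW-> /ltW->] /andP[/ltW-> /ltW->].
have -> : area R (I `*` I) = (2 * 2)%:E.
  by rewrite product_measure1E// EFinM; exact: (congr2 mule muI muI).
exact: ltry.
Qed.

(** On the disk G is a pointwise limit of polynomials, hence measurable, and it is bounded on a set
    of finite area. *)
Lemma taylor_L2 (G k : R[i] -> R[i]) a (B : R) : taylor_on_disk k a ->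
  (forall z, unit_disk z -> G z = k z) -> (forall z, unit_disk z -> normc (k z) <= B) ->
  L2_disk G.
Proof.
move=> /taylorP ka Gk kB.
have mRe : measurable_fun plane_disk (fun p : plane => complex.Re (G (cplx p)) : measurableTypeR R).
  apply: (@measurable_fun_cvg _ _ _ _
    (fun N (p : plane) => complex.Re (psum a (cplx p) N))).
    by move=> N; apply: measurable_funTS; exact: (measurableC_psum a N).1.
  by move=> p pd; rewrite (Gk _ pd); exact: climit_Re (ka _ pd).
have mIm : measurable_fun plane_disk (fun p : plane => complex.Im (G (cplx p)) : measurableTypeR R).
  apply: (@measurable_fun_cvg _ _ _ _
    (fun N (p : plane) => complex.Im (psum a (cplx p) N))).
    by move=> N; apply: measurable_funTS; exact: (measurableC_psum a N).2.
  by move=> p pd; rewrite (Gk _ pd); exact: climit_Im (ka _ pd).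
split => //; have mD := measurable_plane_disk.
apply: (@le_lt_trans _ _ (\int[area R]_(p in plane_disk) (cst (B ^+ 2)%:E p))%E).
  apply: ge0_le_integral => //.
  - by move=> p _; rewrite lee_fin sqr_ge0.
  - by apply/measurable_EFinP; exact: measurable_fun_sqr_normc.
  - move=> p pd; rewrite lee_fin lerXn2r ?nnegrE ?normc_ge0//.
      by apply: le_trans (kB _ pd); exact: normc_ge0.
    by rewrite (Gk _ pd) kB.
rewrite integral_cst//; apply: lte_mul_pinfty => //.
  by rewrite lee_fin sqr_ge0.
exact: plane_disk_finite.
Qed.

(** A point is a product of two null singletons, so a finite set has area 0. *)
Lemma ae_disk_seq (P : R[i] -> Prop) (rs : seq R[i]) :
  (forall z, unit_disk z -> z \notin rs -> P z) -> ae_disk P.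
Proof.
move=> HP; pose N : set plane := [set p | cplx p \in rs].
suff NN : (area R).-negligible N.
  apply: (negligibleS _ NN) => p /= /not_implyP[pd nP]; rewrite /N /=.
  by apply: contrapT => /negP h; apply: nP; exact: HP.
rewrite {HP} /N; elim: rs => [|z rs IH].
  by rewrite (_ : [set _ | _] = set0) ?set0P; [exact: negligible_set0|apply/seteqP; split].
rewrite (_ : [set _ | _] = ([set complex.Re z] `*` [set complex.Im z]) `|`
    [set p | cplx p \in rs]); last first.
  apply/seteqP; split => -[x y]; rewrite /= inE.
    by move=> /orP[/eqP <-|]; [left|right].
  case=> [[/= -> ->]|->]; last by rewrite orbT.
  by case: z => u v; rewrite eqxx.
apply: negligibleU IH; apply/negligibleP; first exact: measurableX.
have := @product_measure1E _ _ _ _ R (@lebesgue_measure R) (@lebesgue_measure R)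
  [set complex.Re z] [set complex.Im z] (measurable_set1 _) (measurable_set1 _).
move=> h; apply: etrans h _.
by apply: etrans (congr2 mule (lebesgue_measure_set1 _) (lebesgue_measure_set1 _)) _; rewrite mule0.
Qed.

End SquareIntegrability.

(** * The extremal map *)

Section SegmentIntegral.
Variable R : realType.

(** For z != 0, t |-> H(t z) / z has derivative phi(t z); the fundamental theorem of calculus is
    applied to its real and imaginary parts, and H 0 = 0. *)
Lemma segment_integral_taylor (phi H : R[i] -> R[i]) b z : taylor_on_disk H b ->
  taylor_on_disk phi (diff_coef b) -> b 0%N = 0 -> unit_disk z ->
  segment_integral phi z = H z.
Proof.
move=> Hb phib b0 zd; rewrite /segment_integral.
have H0 : H 0 = 0 by rewrite (taylor0 Hb).
have [->|z0] := eqVneq z 0; first by rewrite mul0r H0.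
have nz0 : 0 < normc z by rewrite normc_gt0.
have zd' : normc z < 1 by [].
have tz (t : R) : 0 <= t <= 1 -> unit_disk (t%:C * z).
  move=> /andP[t0 t1]; rewrite /unit_disk /= normcM normcR ger0_norm//.
  by apply: le_lt_trans zd'; rewrite ler_piMl// normc_ge0.
have key (pr : R[i] -> R) : (forall v, `|pr v| <= normc v) ->
    (forall v w, pr (v - w) = pr v - pr w) ->
    (forall v (t : R), pr (v * t%:C) = pr v * t) ->
    Rintegral (@lebesgue_measure R) `[0, 1] (fun t : R => pr (phi (t%:C * z))) =
    pr (H z / z).
  move=> prn prB prZ.
  pose psi (t : R) := pr (H (t%:C * z) / z).
  have psiD (t : R) : 0 <= t <= 1 -> is_derive t 1 psi (pr (phi (t%:C * z))).
    move=> t01; apply: is_derive_eps => e e0.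
    have [d d0 Hd] := taylor_rdiff Hb phib (tz _ t01) e0.
    exists (d / normc z); first by rewrite divr_gt0.
    move=> s; rewrite ltr_pdivlMr// => sd; rewrite /psi -prZ -!prB.
    apply: le_trans (prn _) _; have := Hd ((s + t)%:C * z).
    have -> : (s + t)%:C * z - t%:C * z = s%:C * z by rewrite rmorphD /=; ring.
    rewrite mul0r subr0 normcM normcR => /(_ sd) h.
    have -> : H ((s + t)%:C * z) / z - H (t%:C * z) / z - phi (t%:C * z) * s%:C =
      (H ((s + t)%:C * z) - H (t%:C * z) - phi (t%:C * z) * (s%:C * z)) / z by field.
    by rewrite normc_div ler_pdivrMr// -mulrA.
  have psiC (t : R) : 0 <= t <= 1 -> {for t, continuous psi}.
    by move=> /psiD tD; apply: differentiable_continuous; apply/derivable1_diffP; exact: ex_derive.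
  rewrite /Rintegral (continuous_FTC2 ltr01 (F := psi)).
  - have -> : psi 1 = pr (H z / z) by rewrite /psi rmorph1 mul1r.
    have -> : psi 0 = 0.
      by rewrite /psi rmorph0 mul0r H0 mul0r -(mul0r (0 : R)%:C) prZ mulr0.
    by rewrite /= subr0.
  - apply: continuous_in_subspaceT => t; rewrite inE /= in_itv /= => t01.
    apply/cvgrPdist_lt => e e0.
    have [d d0 Hd] := (continuousC _ _).1 (taylor_continuous phib (tz _ t01)) e e0.
    apply/nbhs_normP; exists (d / normc z); first by rewrite /= divr_gt0.
    move=> s /=; rewrite ltr_pdivlMr// distrC => sd.
    rewrite distrC -prB; apply: le_lt_trans (prn _) _; apply: Hd.
    have -> : s%:C * z - t%:C * z = (s - t)%:C * z by rewrite rmorphB /=; ring.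
    by rewrite normcM normcR.
  - split.
    + move=> t; rewrite in_itv /= => /andP[t0 t1].
      by have /psiD h : 0 <= t <= 1 by rewrite !ltW.
    + by apply: cvg_at_right_filter; apply: psiC; rewrite lexx ler01.
    + by apply: cvg_at_left_filter; apply: psiC; rewrite lexx ler01.
  - move=> t; rewrite in_itv /= => /andP[t0 t1].
    by apply: is_derive_derive1; apply: psiD; rewrite !ltW.
rewrite (key (@complex.Re R)) ?(key (@complex.Im R)).
- by rewrite -[RHS](divfK z0) mulrC; congr (_ * _); case: (H z / z).
- exact: Im_le_normc.
- exact: ImB.
- by move=> [u v] t /=; ring.
- exact: Re_le_normc.
- exact: ReB.
- by move=> [u v] t /=; ring.
Qed.

End SegmentIntegral.

(** * The extremal map, with m = n - 1 *)

Section Extremal.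
Variables (R : realType) (lam : R) (m : nat).
Hypotheses (lam1 : 1 <= lam) (m0 : (0 < m)%N).

(** Geometric expansion of the integrand: (lam^3 - lam) / (lam + z^m) is (lam^2 - 1) times the sum
    of (-1/lam)^q z^(m q). *)
Definition extremal_series (j : nat) : R[i] :=
  if (m %| j)%N then (lam ^+ 2 - 1)%:C * (- (lam^-1)%:C) ^+ (j %/ m) else 0.
Local Notation c := extremal_series.

Definition extremal_kernel (z : R[i]) : R[i] := (lam ^+ 3 - lam)%:C / (lam%:C + z ^+ m).
Local Notation phi := extremal_kernel.

(** Termwise integration. At j = 0 the quotient is a division by zero, hence 0, which is the correct
    constant term. *)
Definition extremal_coef (j : nat) : R[i] :=
  (lam ^+ 2)%:C * (j == 1%N)%:R - c j.-1 / j%:R.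

Definition extremal_deriv (z : R[i]) : R[i] := (lam ^+ 2)%:C - phi z.

Let lam0 : 0 < lam. Proof. exact: lt_le_trans lam1. Qed.
Let lam_neq0 : lam%:C != 0 :> R[i].
Proof. by rewrite -normc_eq0 normcR normr_eq0 gt_eqF. Qed.

Lemma extremal_den_neq0 z : unit_disk z -> lam%:C + z ^+ m != 0.
Proof.
move=> zd; rewrite -normc_gt0 -[z ^+ m]opprK.
apply: lt_le_trans (ler_normc_sub _ _); rewrite subr_gt0 normcN normcX normcR gtr0_norm//.
by apply: lt_le_trans lam1; rewrite exprn_ilt1 ?normc_ge0// -?lt0n//.
Qed.

Lemma extremal_series_radius : radius_ge1 c.
Proof.
move=> r /andP[r0 r1]; exists (lam ^+ 2 - 1) => j.
have l2 : 0 <= lam ^+ 2 - 1 by rewrite subr_ge0 exprn_ege1.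
rewrite -[leRHS]mulr1; apply: ler_pM; rewrite ?normc_ge0 ?exprn_ge0 ?(ltW r0)//.
  rewrite /c; case: ifP => _; last by rewrite normc0.
  rewrite normcM normcX normcN !normcR ger0_norm// gtr0_norm ?invr_gt0//.
  by rewrite ler_piMr// exprn_ile1 ?invr_ge0 ?(ltW lam0)// invf_le1.
by rewrite exprn_ile1// ltW.
Qed.

Lemma extremal_series_rec j : lam%:C * c (j + m)%N + c j = 0.
Proof.
rewrite /c dvdn_addl//; case: ifP => [mj|_]; last by rewrite mulr0 addr0.
rewrite divnDr// divnn m0 addn1 (exprS _ (j %/ m)) fmorphV /=.
by field.
Qed.

(** The sum k of the series satisfies k(z) (lam + z^m) = lam^3 - lam: by [extremal_series_rec] all
    coefficients of the product from index m on cancel, and below m only lam * c 0 is nonzero. *)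
Lemma extremal_kernel_taylor : taylor_on_disk phi c.
Proof.
have [k kc] := radius_taylor extremal_series_radius.
suff kE z : unit_disk z -> k z = phi z.
  apply/taylorP => z zd; rewrite -kE//; exact: ((taylorP _ _).1 kc).
move=> zd; have kz := (taylorP _ _).1 kc z zd.
apply: (mulIf (extremal_den_neq0 zd)); rewrite divfK ?extremal_den_neq0//.
have := climitD (climitZ lam%:C (climit_shift m kz)) (climitZ (z ^+ m) kz).
rewrite (_ : lam%:C * k z + _ = k z * (lam%:C + z ^+ m)); last by ring.
move=> h; apply: climit_uniq h _.
apply: climit_eq (climit_cst _) => N.
rewrite /psum addnC big_split_ord /= mulrDr -addrA mulr_sumr [in X in _ = _ + (_ + X)]mulr_sumr.
rewrite mulr_sumr -big_split /= [X in _ = _ + X]big1 ?addr0; last first.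
  move=> i _; rewrite addnC exprD.
  rewrite (_ : _ + _ = (lam%:C * c (i + m)%N + c i) * (z ^+ i * z ^+ m)); last by ring.
  by rewrite extremal_series_rec mul0r.
rewrite (bigD1 (Ordinal m0))//= big1 ?addr0 => [|i i0].
  rewrite /c dvdn0 div0n !expr0 !mulr1 -rmorphM /=; congr (_%:C); ring.
rewrite /c (_ : (m %| i)%N = false) ?mul0r ?mulr0//.
by apply/negbTE; rewrite gtnNdvd// lt0n; apply: contra i0 => /eqP h; apply/eqP/val_inj.
Qed.

Lemma extremal_diff_coef j : diff_coef extremal_coef j = (lam ^+ 2)%:C * (j == 0%N)%:R - c j.
Proof.
have j1 : j.+1%:R != 0 :> R[i] by rewrite pnatr_eq0.
rewrite /diff_coef /extremal_coef /= eqSS; case: eqP => [->|_].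
  by rewrite !mulr1 divr1 mul1r.
by rewrite !mulr0 !sub0r mulrN mulrC divfK.
Qed.

Lemma taylor_monomial (u : R[i]) (k : nat) :
  taylor_on_disk (fun z => u * z ^+ k) (fun j => u * (j == k)%:R).
Proof.
apply/taylorP => z zd e e0; exists k.+1 => n kn.
rewrite /psum (bigD1 (Ordinal kn))//= eqxx mulr1 big1 ?addr0 ?subrr ?normc0//.
move=> i; rewrite -val_eqE /= => /negPf ->; by rewrite mulr0 mul0r.
Qed.

Lemma extremal_deriv_taylor : taylor_on_disk extremal_deriv (diff_coef extremal_coef).
Proof.
have := taylorD (@taylor_monomial (lam ^+ 2)%:C 0) (taylorZ (c := -1) extremal_kernel_taylor).
rewrite (_ : (fun z => _) = extremal_deriv); last first.
  by apply/funext => z; rewrite mulr1 mulN1r.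
rewrite (_ : (fun n => _) = diff_coef extremal_coef)//.
by apply/funext => j; rewrite extremal_diff_coef mulN1r.
Qed.

Lemma extremal_taylor : taylor_on_disk (extremal lam m.+1) extremal_coef.
Proof.
pose b j : R[i] := c j.-1 / j%:R.
have bE : diff_coef b = c.
  by apply/funext => j; rewrite /diff_coef /b /= mulrC divfK// pnatr_eq0.
have b0 : b 0%N = 0 by rewrite /b invr0 mulr0.
have gb : radius_ge1 b.
  move=> r r01; have [r0 r1] := andP r01.
  have [B HB] := extremal_series_radius r01; exists B => -[|j].
    rewrite b0 normc0 mul0r; apply: le_trans (HB 0%N).
    by rewrite mulr_ge0 ?normc_ge0 ?exprn_ge0 ?ltW.
  apply: le_trans (HB j); apply: ler_pM; rewrite ?normc_ge0 ?exprn_ge0 ?(ltW r0)//.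
    rewrite /b normc_div normc_nat /= ler_pdivrMr ?ltr0n//.
    by rewrite ler_peMr ?normc_ge0// ler1n.
  by rewrite exprS ler_piMl ?exprn_ge0 ?ltW.
have [H Hb] := radius_taylor gb.
have HE z : unit_disk z -> segment_integral phi z = H z.
  move=> zd; apply: (segment_integral_taylor Hb _ b0 zd).
  by rewrite bE; exact: extremal_kernel_taylor.
have := taylorD (@taylor_monomial (lam ^+ 2)%:C 1) (taylorZ (c := -1) Hb).
rewrite (_ : (fun n => _) = extremal_coef); last first.
  by apply/funext => j; rewrite mulN1r.
move=> /taylorP h; apply/taylorP => z zd.
rewrite (_ : extremal lam m.+1 z = (lam ^+ 2)%:C * z ^+ 1 + -1 * H z); first exact: h.
by rewrite mulN1r -HE.
Qed.

Lemma extremal_derivE z : unit_disk z ->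
  extremal_deriv z = lam%:C * (1 + lam%:C * z ^+ m) / (lam%:C + z ^+ m).
Proof.
move=> zd; rewrite /extremal_deriv /phi rmorphB !rmorphXn /=.
by field; exact: extremal_den_neq0.
Qed.

(** For v = z^m, |lam + v|^2 - |1 + lam v|^2 = (lam^2 - 1) (1 - |v|^2) >= 0. *)
Lemma extremal_deriv_le z : unit_disk z -> normc (extremal_deriv z) <= lam.
Proof.
move=> zd; rewrite extremal_derivE// normc_div normcM normcR gtr0_norm// -mulrA.
rewrite ler_piMr ?(ltW lam0)// ler_pdivrMr ?normc_gt0 ?extremal_den_neq0// mul1r.
rewrite -(@ler_pXn2r _ 2)// ?nnegrE ?normc_ge0// !sqr_normcE.
have : normc (z ^+ m) ^+ 2 <= 1.
  by rewrite normcX -exprM exprn_ile1 ?normc_ge0// ltW.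
rewrite sqr_normcE; case: (z ^+ m) => u v /= uv.
rewrite !mul0r !add0r !addr0 subr0.
have : 0 <= (lam ^+ 2 - 1) * (1 - (u ^+ 2 + v ^+ 2)).
  by rewrite mulr_ge0// subr_ge0// exprn_ege1.
lra.
Qed.

(** The numerator is a nonzero polynomial, having value 1 at 0; its finitely many roots form the
    exceptional null set for the Jacobian. *)
Lemma extremal_deriv_zeros : exists rs : seq R[i],
  forall z, unit_disk z -> z \notin rs -> extremal_deriv z != 0.
Proof.
pose p : {poly R[i]} := lam%:C *: 'X^m + 1.
have [rs pE] := closed_field_poly_normal p.
have p0 : lead_coef p != 0.
  rewrite lead_coef_eq0; apply/negP => /eqP/(congr1 (fun q : {poly R[i]} => q.[0])).
  rewrite !hornerE expr0n gtn_eqF// mulr0 add0r => /eqP; by rewrite oner_eq0.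
exists rs => z zd; rewrite -root_prod_XsubC -(rootZ _ _ p0) -pE /root !hornerE => pz.
rewrite extremal_derivE// mulf_neq0 ?invr_eq0 ?extremal_den_neq0//.
by rewrite mulf_neq0// addrC.
Qed.

Lemma extremal_dz z : unit_disk z -> dz (extremal lam m.+1) z = extremal_deriv z.
Proof. exact: (holo_dz (fun _ _ => erefl) extremal_taylor extremal_deriv_taylor). Qed.

Lemma extremal_dzbar z : unit_disk z -> dzbar (extremal lam m.+1) z = 0.
Proof. exact: (holo_dzbar (fun _ _ => erefl) extremal_taylor extremal_deriv_taylor). Qed.

Lemma extremal_elliptic : elliptic 1 0 (extremal lam m.+1).
Proof.
have Fa := extremal_taylor; split.
- exact: taylor_continuous Fa.
- exact: taylor_sense_preserving Fa.
- exact: taylor_ACL Fa.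
- split.
  + exact: taylor_L2 extremal_deriv_taylor extremal_dz extremal_deriv_le.
  + have zero : taylor_on_disk (fun=> 0 : R[i]) (fun j => 0 * (j == 0%N)%:R).
      have := @taylor_monomial 0 0.
      by rewrite (_ : (fun z => _) = fun=> 0)//; apply/funext => z; rewrite mul0r.
    by apply: (taylor_L2 (B := 0) zero extremal_dzbar) => z _; rewrite normc0.
  + have [rs Hrs] := extremal_deriv_zeros.
    apply: (@ae_disk_seq _ _ rs) => z zd zrs.
    rewrite /jac extremal_dz// extremal_dzbar// normc0 expr0n subr0.
    by rewrite expf_neq0// normc_eq0 Hrs.
(* No exceptional point: with f_zbar = 0 both sides equal |f_z|^2. *)
- apply: (@ae_disk_seq _ _ [::]) => z zd _.
  by rewrite op_norm_formal /jac extremal_dzbar// normc0 addr0 expr0n subr0 mul1r addr0.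
Qed.

Lemma extremal_min_dilation z : unit_disk z ->
  min_dilation (extremal lam m.+1) z = normc (extremal_deriv z).
Proof.
move=> zd; rewrite /min_dilation extremal_dz// extremal_dzbar// normc0 subr0.
by rewrite ger0_norm// normc_ge0.
Qed.

Lemma extremal_deriv0 : extremal_deriv 0 = 1.
Proof.
rewrite (extremal_derivE (unit_disk0 R)) expr0n gtn_eqF//= mulr0 !addr0 mulr1.
by rewrite divff.
Qed.

(** For K = 1 and K' = 0 the quadratic equation gives M = lam, and the coefficient of index m + 1
    has modulus (lam^2 - 1) / lam divided by m + 1. *)
Lemma extremal_coef_bound :
  normc (extremal_coef m.+1) = coef_bound 1 0 lam m.+1.
Proof.
have M2 := @dilation_bound_sqr R 1 0 lam (lexx (0 : R)).
have M0 := dilation_bound_gt0 (lexx (1 : R)) (lexx (0 : R)) lam1.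
rewrite coef_boundE//.
have -> : dilation_bound 1 0 lam = lam.
  by move: M2; rewrite mul1r addr0 expr2 => /(mulIf (lt0r_neq0 M0)).
rewrite /extremal_coef /= eqSS gtn_eqF// mulr0 sub0r normcN normc_div normc_nat mulrC.
congr (_ * _); rewrite /c dvdnn divnn m0 expr1 normcM normcN !normcR.
rewrite ger0_norm ?subr_ge0 ?exprn_ege1// gtr0_norm ?invr_gt0//.
by field; rewrite gt_eqF.
Qed.

End Extremal.

Local Open Scope complex_scope.

Theorem theorem1 (R : realType) :
  (forall (K K' lambda : R) (f h g : R[i] -> R[i]) (a b : nat -> R[i]),
     1 <= K -> 0 <= K' ->
     elliptic K K' f -> harmonic_map f ->
     (forall z, unit_disk z -> f z = h z + (g z)^*) ->
     taylor_on_disk h a -> taylor_on_disk g b -> b 0%N = 0 ->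
     f 0 = 0 -> min_dilation f 0 = 1 ->
     (forall z, unit_disk z -> min_dilation f z <= lambda) ->
     forall n : nat, (2 <= n)%N ->
       normc (a n) + normc (b n) <= coef_bound K K' lambda n) /\
  (forall (lambda : R) (n : nat), 1 <= lambda -> (2 <= n)%N ->
     exists (h g : R[i] -> R[i]) (a b : nat -> R[i]),
       let F := extremal lambda n in
       (elliptic 1 0 F /\ harmonic_map F) /\
       [/\ forall z, unit_disk z -> F z = h z + (g z)^*,
           taylor_on_disk h a, taylor_on_disk g b & b 0%N = 0] /\
       [/\ F 0 = 0, min_dilation F 0 = 1 &
           forall z, unit_disk z -> min_dilation F z <= lambda] /\
       normc (a n) + normc (b n) = coef_bound 1 0 lambda n).
Proof.
split=> [K K' lambda f h g a b K1 K'0 [_ _ _ _ qc] _ fhg ha gb _ _|].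
  exact: elliptic_harmonic_coef_bound qc fhg ha gb.
(* Writing the index as n.+1 turns the hypothesis into [0 < n], and n is the exponent m of the
   extremal section. *)
move=> lambda n lam1; case: n => // n n0.
exists (extremal lambda n.+1), (fun=> 0), (extremal_coef lambda n), (fun=> 0).
have Fa := extremal_taylor lam1 n0; split; last split; last split.
- by split; [exact: extremal_elliptic|exact: taylor_harmonic Fa].
- split; [by move=> z _; rewrite conjC0 addr0|exact: Fa| |by []].
  have := @taylor_monomial R 0 0.
  rewrite (_ : (fun z => _) = fun=> 0); last by apply/funext => z; rewrite mul0r.
  by rewrite (_ : (fun j => _) = fun=> 0)//; apply/funext => j; rewrite mul0r.
- split; first by rewrite (taylor0 Fa) /extremal_coef mulr0 invr0 mulr0 subr0.
    by rewrite extremal_min_dilation//; [rewrite extremal_deriv0// normc1|exact: unit_disk0].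
  by move=> z zd; rewrite extremal_min_dilation// extremal_deriv_le.
- by rewrite normc0 addr0 extremal_coef_bound.
Qed.
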